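(* For every integer $n\ge3$, under the identification $\mathsf{F}_2/\mathsf{K}^{(n)}_{\mathsf{F}_2}\cong G_n\le D_n^3$ and with residue classes modulo $K^{(n)}_{\mathrm{ord}}$ represented by integers in $\{0,1,\dots,K^{(n)}_{\mathrm{ord}}-1\}$, the set of $\mathsf{GT}$-shadows with the target $\mathsf{K}^{(n)}$ is $$ \mathsf{GT}(\mathsf{K}^{(n)})=\begin{cases}\big\{(m,(r^{2k},r^{-2k},r^{\varkappa(m)}))\ \big|\ m\in\mathcal{X}_n,\ k\in\mathbb{Z},\ k\equiv\frac{\varkappa(m)}{2}\bmod 2\big\}&\text{if }4\mid n,\\[4pt]\big\{(m,(r^{2k},r^{-2k},r^{\varkappa(m)}))\ \big|\ m\in\mathcal{X}_n,\ k\in\mathbb{Z}\big\}&\text{if }4\nmid n,\end{cases} $$ where $\mathcal{X}_n:=\{m\in\{0,1,\dots,K^{(n)}_{\mathrm{ord}}-1\}\mid\gcd(2m+1,K^{(n)}_{\mathrm{ord}})=1\}$ and $\varkappa(m):=m+1$ if $m$ is odd, $\varkappa(m):=-m$ if $m$ is even. Furthermore, $\mathsf{K}^{(n)}$ is an isolated object of the groupoid $\mathsf{GTSh}$.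
   Context: **Braid groups.** $\mathrm{B}_3=\langle \sigma_1,\sigma_2\mid \sigma_1\sigma_2\sigma_1=\sigma_2\sigma_1\sigma_2\rangle$; $\mathrm{PB}_3$ is the kernel of the standard homomorphism $\mathrm{B}_3\to S_3$; $x_{12}:=\sigma_1^2$, $x_{23}:=\sigma_2^2$, $c:=(\sigma_1\sigma_2\sigma_1)^2$. One has $\mathrm{PB}_3=\langle x_{12},x_{23}\rangle\times\langle c\rangle$ with $\langle x_{12},x_{23}\rangle$ free; $\mathsf{F}_2$ denotes the subgroup $\langle x_{12},x_{23}\rangle$, with $x:=x_{12}$, $y:=x_{23}$. $\mathsf{NFI}_{\mathrm{PB}_3}(\mathrm{B}_3)$ is the set of finite index normal subgroups $\mathsf{N}\unlhd\mathrm{B}_3$ with $\mathsf{N}\le\mathrm{PB}_3$. For such $\mathsf{N}$: $\mathsf{N}_{\mathsf{F}_2}:=\mathsf{N}\cap\mathsf{F}_2$, and $N_{\mathrm{ord}}$ is the lcm of the orders of $x_{12}\mathsf{N}$, $x_{23}\mathsf{N}$, $c\mathsf{N}$ in $\mathrm{PB}_3/\mathsf{N}$. **$\mathsf{GT}$-shadows.** For $(m,f)\in\mathbb{Z}\times\mathsf{F}_2$, $[m,f]:=(m+N_{\mathrm{ord}}\mathbb{Z}, f\mathsf{N}_{\mathsf{F}_2})$. $\mathsf{GT}(\mathsf{N})$ (the set of $\mathsf{GT}$-shadows with the target $\mathsf{N}$) is the set of those $[m,f]\in\mathbb{Z}/N_{\mathrm{ord}}\mathbb{Z}\times\mathsf{F}_2/\mathsf{N}_{\mathsf{F}_2}$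 such that: (i) the hexagon relations hold: $\sigma_1^{2m+1}f^{-1}\sigma_2^{2m+1}f\,\mathsf{N}=f^{-1}\sigma_1\sigma_2x_{12}^{-m}c^m\,\mathsf{N}$ and $f^{-1}\sigma_2^{2m+1}f\sigma_1^{2m+1}\,\mathsf{N}=\sigma_2\sigma_1x_{23}^{-m}c^mf\,\mathsf{N}$; (ii) $\gcd(2m+1,N_{\mathrm{ord}})=1$ and $f\mathsf{N}_{\mathsf{F}_2}\in[\mathsf{F}_2/\mathsf{N}_{\mathsf{F}_2},\mathsf{F}_2/\mathsf{N}_{\mathsf{F}_2}]$; (iii) the homomorphism $T_{m,f}:\mathrm{B}_3\to\mathrm{B}_3/\mathsf{N}$, $\sigma_1\mapsto\sigma_1^{2m+1}\mathsf{N}$, $\sigma_2\mapsto f^{-1}\sigma_2^{2m+1}f\,\mathsf{N}$ (well defined by (i)), is surjective. **The groupoid $\mathsf{GTSh}$.** Its objects are the elements of $\mathsf{NFI}_{\mathrm{PB}_3}(\mathrm{B}_3)$, and the morphisms from $\mathsf{K}$ to $\mathsf{N}$ are the $[m,f]\in\mathsf{GT}(\mathsf{N})$ with $\ker T_{m,f}=\mathsf{K}$ (composition: $[m_1,f_1]\circ[m_2,f_2]=[2m_1m_2+m_1+m_2,\ f_1E_{m_1,f_1}(f_2)]$ with $E_{m,f}(x)=x^{2m+1}$, $E_{m,f}(y)=f^{-1}y^{2m+1}f$). $\mathsf{N}$ is isolated if it is the only object of its connected component in $\mathsf{GTSh}$; equivalently, $\ker T_{m,f}=\mathsf{N}$ for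 every $[m,f]\in\mathsf{GT}(\mathsf{N})$. **The subgroups $\mathsf{K}^{(n)}$.** For an integer $n\ge3$ let $D_n=\langle r,s\mid r^n,s^2,srs^{-1}r\rangle$, and let $\psi_n:\mathrm{PB}_3\to D_n^3$ be the homomorphism $\psi_n(x_{12})=(r,s,s)$, $\psi_n(x_{23})=(rs,r,rs)$, $\psi_n(c)=(1,1,1)$. Set $\mathsf{K}^{(n)}:=\ker\psi_n$, which is an element of $\mathsf{NFI}_{\mathrm{PB}_3}(\mathrm{B}_3)$, with $K^{(n)}_{\mathrm{ord}}=\mathrm{lcm}(n,2)$. Via $\psi_n$, the group $\mathsf{F}_2/\mathsf{K}^{(n)}_{\mathsf{F}_2}$ is identified with the subgroup $G_n:=\langle(r,s,s),(rs,r,rs)\rangle\le D_n^3$. *)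

(* Defs.v *)
From HB Require Import structures.
From Stdlib Require Import Relation_Operators.
From mathcomp Require Import all_boot all_order all_algebra perm.
From mathcomp Require Import generic_quotient boolp classical_sets functions cardinality.

Set Implicit Arguments.
Unset Strict Implicit.
Unset Printing Implicit Defensive.

Local Open Scope classical_set_scope.
Local Open Scope quotient_scope.
Local Open Scope group_scope.

Record subgroup (G : groupType) := Subgroup {
  subgroup_set : set G;
  subgroup_closed : group_closed (mem subgroup_set) }.

Definition in_subgroup (G : groupType) (H : subgroup G) : G -> Prop := subgroup_set H.
Coercion in_subgroup : subgroup >-> Funclass.

Record normal_subgroup (G : groupType) := NormalSubgroup {
  normal_subgroup_sub :> subgroup G;
  normalP : forall x g : G, normal_subgroup_sub x -> normal_subgroup_sub (x ^ g) }.

Definition generated (G : groupType) (S : set G) : set G :=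
  smallest (fun H : set G => group_closed (mem H)) S.

Section SubgroupTheory.
Variable G : groupType.

Lemma group_closedP (H : set G) :
  H 1 -> (forall x y, H x -> H y -> H (x * y)) -> (forall x, H x -> H x^-1) ->
  group_closed (mem H).
Proof.
move=> H1 HM HV; split; first exact/mem_set.
by move=> x y /set_mem Hx /set_mem Hy; apply/mem_set/HM => //; apply: HV.
Qed.

Variable H : subgroup G.

Lemma subgroup1 : H 1.
Proof. by case: (subgroup_closed H) => /set_mem. Qed.

Lemma subgroupV x : H x -> H x^-1.
Proof.
by move=> Hx; have /(_ x) := group_closedV (subgroup_closed H);
  move=> /(_ (mem_set Hx))/set_mem.
Qed.

Lemma subgroupM x y : H x -> H y -> H (x * y).
Proof.
move=> Hx Hy; apply/set_mem.
exact: (group_closedM (subgroup_closed H)) (mem_set Hx) (mem_set Hy).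
Qed.

End SubgroupTheory.

Lemma generated_closed (G : groupType) (S : set G) :
  group_closed (mem (generated S)).
Proof.
apply: group_closedP => [A [Acl _]|x y Sx Sy A [Acl SA]|x Sx A [Acl SA]].
- exact: (subgroup1 (Subgroup Acl)).
- by apply: (@subgroupM _ (Subgroup Acl)); [apply: Sx|apply: Sy].
- by apply: (@subgroupV _ (Subgroup Acl)); apply: Sx.
Qed.

Definition generated_subgroup (G : groupType) (S : set G) : subgroup G :=
  Subgroup (generated_closed S).

Definition derived_subgroup (G : groupType) : subgroup G :=
  generated_subgroup [set c : G | exists a b : G, c = [~ a, b]].

Definition subgroup_type (G : groupType) (H : subgroup G) : Type :=
  {x : G | x \in subgroup_set H}.

Section SubgroupType.
Variables (G : groupType) (H : subgroup G).
HB.instance Definition _ := SubChoice.on (subgroup_type H).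
HB.instance Definition _ :=
  SubChoice_isSubGroup.Build G (mem (subgroup_set H)) (subgroup_type H) (subgroup_closed H).
End SubgroupType.

Coercion subgroup_type : subgroup >-> Sortclass.

Section Quotient.
Variables (G : groupType) (N : normal_subgroup G).

Definition coset_eq (x y : G) : bool := `[< N (x^-1 * y) >].

Lemma coset_eq_refl : reflexive coset_eq.
Proof. by move=> x; apply/asboolP; rewrite mulVg; apply: subgroup1. Qed.
Lemma coset_eq_sym : symmetric coset_eq.
Proof.
suff H x y : coset_eq x y -> coset_eq y x by move=> x y; apply/idP/idP; apply: H.
by move=> /asboolP/subgroupV; rewrite invgM invgK => ?; apply/asboolP.
Qed.
Lemma coset_eq_trans : transitive coset_eq.
Proof.
move=> y x z /asboolP xy /asboolP yz; apply/asboolP.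
by have := subgroupM xy yz; rewrite -mulgA mulVKg.
Qed.

Canonical coset_equiv := EquivRel coset_eq coset_eq_refl coset_eq_sym coset_eq_trans.

(* The quotient group G / N; the class of g is [\pi_(quotient N) g]. *)
Definition quotient : Type := {eq_quot coset_equiv}.
HB.instance Definition _ := Choice.on quotient.
HB.instance Definition _ : EqQuotient G coset_equiv quotient := EqQuotient.on quotient.

Lemma quotient_eq (x y : G) : (\pi_quotient x = \pi_quotient y) <-> N (x^-1 * y).
Proof. by split=> [/eqmodP/asboolP|Nxy] //; apply/eqmodP/asboolP. Qed.

Definition quotient_mul (a b : quotient) : quotient := \pi_quotient (repr a * repr b).
Definition quotient_one : quotient := \pi_quotient 1.
Definition quotient_inv (a : quotient) : quotient := \pi_quotient (repr a)^-1.

Lemma quotient_repr (x : G) : N (x^-1 * repr (\pi_quotient x)).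
Proof. by apply/quotient_eq; rewrite reprK. Qed.

Lemma quotient_pi_mul x y :
  quotient_mul (\pi_quotient x) (\pi_quotient y) = \pi_quotient (x * y).
Proof.
apply/esym/quotient_eq; have Nx := quotient_repr x; have Ny := quotient_repr y.
move: (repr (\pi_quotient x)) (repr (\pi_quotient y)) Nx Ny => x' y' Nx Ny.
have -> : (x * y)^-1 * (x' * y') = (x^-1 * x') ^ y * (y^-1 * y').
  by rewrite conjgE invgM !mulgA mulgK.
by apply: subgroupM Ny; apply: normalP.
Qed.

Lemma quotient_pi_inv x : quotient_inv (\pi_quotient x) = \pi_quotient x^-1.
Proof.
apply/esym/quotient_eq; have Nx := quotient_repr x.
move: (repr (\pi_quotient x)) Nx => x' Nx; rewrite invgK.
have -> : x * x'^-1 = (x^-1 * x')^-1 ^ x^-1.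
  by rewrite conjgE invgM !invgK !mulgA mulgK.
by apply: normalP; apply: subgroupV.
Qed.

Lemma quotient_mulA : associative quotient_mul.
Proof.
move=> a b c; rewrite -[a]reprK -[b]reprK -[c]reprK.
move: (repr a) (repr b) (repr c) => x y z.
by rewrite (quotient_pi_mul y) (quotient_pi_mul x y) (quotient_pi_mul x) quotient_pi_mul mulgA.
Qed.
Lemma quotient_mul1g : left_id quotient_one quotient_mul.
Proof. by move=> a; rewrite -[a]reprK quotient_pi_mul mul1g. Qed.
Lemma quotient_mulg1 : right_id quotient_one quotient_mul.
Proof. by move=> a; rewrite -[a]reprK quotient_pi_mul mulg1. Qed.
Lemma quotient_mulVg : left_inverse quotient_one quotient_inv quotient_mul.
Proof. by move=> a; rewrite -[a]reprK quotient_pi_inv quotient_pi_mul mulVg. Qed.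
Lemma quotient_mulgV : right_inverse quotient_one quotient_inv quotient_mul.
Proof. by move=> a; rewrite -[a]reprK quotient_pi_inv quotient_pi_mul mulgV. Qed.

HB.instance Definition _ := isGroup.Build quotient
  quotient_mulA quotient_mul1g quotient_mulg1 quotient_mulVg quotient_mulgV.

Lemma quotient_piM x y :
  \pi_quotient (x * y) = \pi_quotient x * \pi_quotient y :> quotient.
Proof. exact/esym/quotient_pi_mul. Qed.
Lemma quotient_pi1 : \pi_quotient 1 = 1 :> quotient.
Proof. by []. Qed.
Lemma quotient_piV x : \pi_quotient x^-1 = (\pi_quotient x)^-1 :> quotient.
Proof. exact/esym/quotient_pi_inv. Qed.

End Quotient.

(* The order of an element; 0 if the order is infinite. *)
Definition order_elt (G : groupType) (x : G) : nat :=
  if pselect (exists k, (0 < k)%N && (x ^+ k == 1)) is left e then ex_minn e else 0%N.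

Definition zexp (G : groupType) (x : G) (k : int) : G :=
  match k with Posz n => x ^+ n | Negz n => x ^- n.+1 end.

(* Words in the generators and their formal inverses: [(i, false)] stands for
   the generator i and [(i, true)] for its inverse. *)
Definition word (I : Type) : Type := seq (I * bool).

Section Presentation.
Variables (I : choiceType) (R : seq (word I * word I)).

Inductive word_eq : word I -> word I -> Prop :=
| word_eq_refl u : word_eq u u
| word_eq_sym u v : word_eq u v -> word_eq v u
| word_eq_trans u v w : word_eq u v -> word_eq v w -> word_eq u w
| word_eq_cat u u' v v' :
    word_eq u u' -> word_eq v v' -> word_eq (u ++ v) (u' ++ v')
| word_eq_cancel i b : word_eq [:: (i, b); (i, ~~ b)] [::]
| word_eq_rel u v : (u, v) \in R -> word_eq u v.

Definition word_eqb (u v : word I) : bool := `[< word_eq u v >].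
Lemma word_eqb_refl : reflexive word_eqb.
Proof. by move=> u; apply/asboolP; apply: word_eq_refl. Qed.
Lemma word_eqb_sym : symmetric word_eqb.
Proof. by move=> u v; apply/asboolP/asboolP; apply: word_eq_sym. Qed.
Lemma word_eqb_trans : transitive word_eqb.
Proof.
by move=> v u w /asboolP uv /asboolP vw; apply/asboolP; apply: word_eq_trans uv vw.
Qed.
Canonical word_equiv := EquivRel word_eqb word_eqb_refl word_eqb_sym word_eqb_trans.

(* The group with generators I and relations u = v for (u, v) in R. *)
Definition presented : Type := {eq_quot word_equiv}.
HB.instance Definition _ := Choice.on presented.
HB.instance Definition _ : EqQuotient (word I) word_equiv presented :=
  EqQuotient.on presented.

Lemma presented_eq u v : (\pi_presented u = \pi_presented v) <-> word_eq u v.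
Proof. by split=> [/eqmodP/asboolP|?] //; apply/eqmodP/asboolP. Qed.

Definition word_inv (u : word I) : word I := rev [seq (l.1, ~~ l.2) | l <- u].

Lemma word_mulVw w : word_eq (word_inv w ++ w) [::].
Proof.
elim: w => [|[i b] w IHw]; first exact: word_eq_refl.
rewrite /word_inv /= rev_cons -cats1 -catA /=.
apply: word_eq_trans IHw; apply: word_eq_cat (word_eq_refl _) _.
rewrite -[X in word_eq _ X]cat0s -[X in word_eq X _](cat_cons _ [:: _] w).
apply: word_eq_cat (word_eq_refl _); rewrite -{2}[b]negbK.
exact: word_eq_cancel.
Qed.

Lemma word_invK : involutive word_inv.
Proof.
move=> w; rewrite /word_inv map_rev revK -map_comp -[RHS]map_id; apply: eq_map.
by case=> i b /=; rewrite negbK.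
Qed.

Lemma word_eq_inv u v : word_eq u v -> word_eq (word_inv u) (word_inv v).
Proof.
move=> uv; apply: (@word_eq_trans _ (word_inv u ++ (v ++ word_inv v))).
  rewrite -{1}[word_inv u]cats0; apply: word_eq_cat (word_eq_refl _) _.
  by apply: word_eq_sym; rewrite -{1}[v]word_invK; apply: word_mulVw.
rewrite catA -{2}[word_inv v]cat0s; apply: word_eq_cat (word_eq_refl _).
apply: word_eq_trans (word_mulVw u); apply: word_eq_cat (word_eq_refl _) _.
exact: word_eq_sym.
Qed.

Definition presented_mul (a b : presented) : presented :=
  \pi_presented (repr a ++ repr b).
Definition presented_one : presented := \pi_presented [::].
Definition presented_inv (a : presented) : presented :=
  \pi_presented (word_inv (repr a)).

Lemma presented_repr u : word_eq (repr (\pi_presented u)) u.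
Proof. by apply/presented_eq; rewrite reprK. Qed.

Lemma presented_pi_mul u v :
  presented_mul (\pi_presented u) (\pi_presented v) = \pi_presented (u ++ v).
Proof. by apply/presented_eq; apply: word_eq_cat; apply: presented_repr. Qed.
Lemma presented_pi_inv u :
  presented_inv (\pi_presented u) = \pi_presented (word_inv u).
Proof. by apply/presented_eq; apply/word_eq_inv/presented_repr. Qed.

Lemma presented_mulA : associative presented_mul.
Proof.
move=> a b c; rewrite -[a]reprK -[b]reprK -[c]reprK.
move: (repr a) (repr b) (repr c) => x y z.
by rewrite (presented_pi_mul y) (presented_pi_mul x y) (presented_pi_mul x) presented_pi_mul catA.
Qed.
Lemma presented_mul1g : left_id presented_one presented_mul.
Proof. by move=> a; rewrite -[a]reprK presented_pi_mul. Qed.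
Lemma presented_mulg1 : right_id presented_one presented_mul.
Proof. by move=> a; rewrite -[a]reprK presented_pi_mul cats0. Qed.
Lemma presented_mulVg : left_inverse presented_one presented_inv presented_mul.
Proof.
move=> a; rewrite -[a]reprK presented_pi_inv presented_pi_mul.
exact/presented_eq/word_mulVw.
Qed.
Lemma presented_mulgV : right_inverse presented_one presented_inv presented_mul.
Proof.
move=> a; rewrite -[a]reprK presented_pi_inv presented_pi_mul.
by apply/presented_eq; rewrite -{1}[repr a]word_invK; apply: word_mulVw.
Qed.

HB.instance Definition _ := isGroup.Build presented
  presented_mulA presented_mul1g presented_mulg1 presented_mulVg presented_mulgV.

Lemma presented_piM u v :
  \pi_presented u * \pi_presented v = \pi_presented (u ++ v) :> presented.
Proof. exact: presented_pi_mul. Qed.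

Definition gen (i : I) : presented := \pi_presented [:: (i, false)].

(* The value of a word when the generators take the values h i. *)
Definition word_val (H : groupType) (h : I -> H) (u : word I) : H :=
  \prod_(l <- u) (if l.2 then (h l.1)^-1 else h l.1).

(* The homomorphism sending the generator i to h i. It is meaningful only if the
   relations R hold for h in H, see [presented_hom_morph]. *)
Definition presented_hom (H : groupType) (h : I -> H) (a : presented) : H :=
  word_val h (repr a).

End Presentation.

Section PresentationTheory.
Variables (I : choiceType) (R : seq (word I * word I)).

Lemma presented_ind (P : presented R -> Prop) :
  P 1 -> (forall a i, P a -> P (a * gen R i)) ->
  (forall a i, P a -> P (a * (gen R i)^-1)) -> forall a, P a.
Proof.
move=> P1 Pg PV a; rewrite -[a]reprK; elim/last_ind: (repr a) => // w [i b] Pw.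
rewrite -cats1 -presented_piM; case: b => /=; last exact: Pg.
suff -> : \pi_(presented R) [:: (i, true)] = (gen R i)^-1 by exact: PV.
exact/esym/presented_pi_inv.
Qed.

Lemma word_val_cat (H : groupType) (h : I -> H) u v :
  word_val h (u ++ v) = word_val h u * word_val h v.
Proof. exact: big_cat. Qed.

Variables (H : groupType) (h : I -> H).
Hypothesis hR : forall u v, (u, v) \in R -> word_val h u = word_val h v.

Lemma word_val_eq u v : word_eq R u v -> word_val h u = word_val h v.
Proof.
elim=> {u v} //.
- by move=> u v w _ -> _ ->.
- by move=> u u' v v' _ Hu _ Hv; rewrite !word_val_cat Hu Hv.
- move=> i b; rewrite /word_val !big_cons !big_nil mulg1 /=.
  by case: b => /=; rewrite (mulgV, mulVg).
Qed.

Lemma presented_hom_morph : {morph @presented_hom I R H h : a b / a * b}.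
Proof.
move=> a b; rewrite -[a]reprK -[b]reprK; move: (repr a) (repr b) => u v.
rewrite presented_piM.
rewrite /presented_hom !(word_val_eq (presented_repr _ _)).
exact: word_val_cat.
Qed.

Lemma presented_hom_gen i : presented_hom h (gen R i) = h i.
Proof.
rewrite /presented_hom (word_val_eq (presented_repr _ _)).
by rewrite /word_val big_cons big_nil mulg1.
Qed.

Lemma presented_hom1 : @presented_hom I R H h 1 = 1.
Proof.
by apply: (@mulgI _ (presented_hom h (1 : presented R))); rewrite -presented_hom_morph !mulg1.
Qed.

Lemma presented_homV : {morph @presented_hom I R H h : a / a^-1}.
Proof.
move=> a; apply: (@mulgI _ (presented_hom h a)).
by rewrite -presented_hom_morph !mulgV presented_hom1.
Qed.

End PresentationTheory.

(* sigma_1 and sigma_2 are the generators [false] and [true]. *)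
Definition braid_relation : seq (word bool * word bool) :=
  let s1 := (false, false) in let s2 := (true, false) in
  [:: ([:: s1; s2; s1], [:: s2; s1; s2])].

Definition B3 : groupType := presented braid_relation.
Definition sigma1 : B3 := gen braid_relation false.
Definition sigma2 : B3 := gen braid_relation true.

(* The homomorphism sigma1 |-> a, sigma2 |-> b; meaningful if a b a = b a b. *)
Definition braid_hom (H : groupType) (a b : H) : B3 -> H :=
  @presented_hom _ braid_relation H (fun i => if i then b else a).

Section BraidHom.
Variables (H : groupType) (a b : H).
Hypothesis braid_ab : a * b * a = b * a * b.

Lemma braid_hom_rel (u v : word bool) : (u, v) \in braid_relation ->
  word_val (fun i : bool => if i then b else a) u =
  word_val (fun i : bool => if i then b else a) v.
Proof.
rewrite inE => /eqP[-> ->]; rewrite /word_val !big_cons !big_nil /= !mulg1.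
by rewrite !mulgA.
Qed.

Lemma braid_homM : {morph braid_hom a b : x y / x * y}.
Proof. exact: presented_hom_morph braid_hom_rel. Qed.
Lemma braid_homV : {morph braid_hom a b : x / x^-1}.
Proof. exact: presented_homV braid_hom_rel. Qed.
Lemma braid_hom1 : braid_hom a b 1 = 1.
Proof. exact: presented_hom1 braid_hom_rel. Qed.
Lemma braid_hom_sigma1 : braid_hom a b sigma1 = a.
Proof. exact: (presented_hom_gen braid_hom_rel). Qed.
Lemma braid_hom_sigma2 : braid_hom a b sigma2 = b.
Proof. exact: (presented_hom_gen braid_hom_rel). Qed.

End BraidHom.

Lemma braidE : sigma1 * sigma2 * sigma1 = sigma2 * sigma1 * sigma2.
Proof.
have M := @presented_piM _ braid_relation.
rewrite /sigma1 /sigma2 /gen !(M [:: _] [:: _]) !(M [:: _; _] [:: _]).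
by apply/presented_eq/word_eq_rel; rewrite inE.
Qed.

Lemma B3_ind (P : B3 -> Prop) :
  P 1 -> (forall a, P a -> P (a * sigma1)) -> (forall a, P a -> P (a * sigma2)) ->
  (forall a, P a -> P (a * sigma1^-1)) -> (forall a, P a -> P (a * sigma2^-1)) ->
  forall a, P a.
Proof. by move=> P1 ? ? ? ?; apply: presented_ind => // a []; auto. Qed.

Definition braid_perm : B3 -> 'S_3 :=
  braid_hom (tperm (inord 0) (inord 1)) (tperm (inord 1) (inord 2)).

Lemma tperm_braid : let a : 'S_3 := tperm (inord 0) (inord 1) in
  let b : 'S_3 := tperm (inord 1) (inord 2) in a * b * a = b * a * b.
Proof.
apply/permP => i; rewrite !permM; have [-> -> ->] : [/\ inord 0 = @Ordinal 3 0 isT,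
  inord 1 = @Ordinal 3 1 isT & inord 2 = @Ordinal 3 2 isT].
  by split; apply: val_inj; rewrite /= inordK.
case: i => [[|[|[|i]]] Hi] //; do 6?rewrite permE /=; exact: val_inj.
Qed.

Definition PB3 : set B3 := [set x | braid_perm x = 1].

Definition x12 : B3 := sigma1 ^+ 2.
Definition x23 : B3 := sigma2 ^+ 2.
Definition cc : B3 := (sigma1 * sigma2 * sigma1) ^+ 2.

Definition F2 : subgroup B3 := generated_subgroup [set x12; x23].

Record NFI := MkNFI {
  NFI_normal :> normal_subgroup B3;
  NFI_pure : subgroup_set NFI_normal `<=` PB3;
  NFI_finite_index : finite_set [set: quotient NFI_normal] }.

Lemma valF2_1 : val (1 : F2) = 1 :> B3. Proof. exact: val1. Qed.
Lemma valF2_M (f g : F2) : val (f * g) = val f * val g :> B3.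
Proof. exact: valM. Qed.
Lemma valF2_V (f : F2) : val f^-1 = (val f)^-1 :> B3.
Proof. by apply: (@mulgI _ (val f)); rewrite -valF2_M !mulgV valF2_1. Qed.
Lemma valF2_J (f g : F2) : val (f ^ g) = val f ^ val g :> B3.
Proof. by rewrite !conjgE !valF2_M valF2_V. Qed.

Section GTShadows.
Variable N : NFI.

Lemma NF2_closed : group_closed (mem [set f : F2 | N (val f)]).
Proof.
apply: group_closedP => [|f g Nf Ng|f Nf].
- by rewrite /mkset valF2_1; apply: subgroup1.
- by rewrite /mkset valF2_M; apply: subgroupM.
- by rewrite /mkset valF2_V; apply: subgroupV.
Qed.

Lemma NF2_normal (f g : F2) : N (val f) -> N (val (f ^ g)).
Proof. by rewrite valF2_J; apply: normalP. Qed.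

Definition NF2 : normal_subgroup F2 :=
  @NormalSubgroup F2 (Subgroup NF2_closed) NF2_normal.

Definition Nord : nat :=
  lcmn (order_elt (\pi_(quotient N) x12))
    (lcmn (order_elt (\pi_(quotient N) x23)) (order_elt (\pi_(quotient N) cc))).

Definition eqmodN (a b : int) : bool := (a == b %[mod (Nord : int)])%Z.
Lemma eqmodN_refl : reflexive eqmodN. Proof. by move=> a; exact: eqxx. Qed.
Lemma eqmodN_sym : symmetric eqmodN. Proof. by move=> a b; exact: eq_sym. Qed.
Lemma eqmodN_trans : transitive eqmodN.
Proof. by move=> b a c; rewrite /eqmodN => /eqP ->. Qed.
Canonical eqmodN_equiv := EquivRel eqmodN eqmodN_refl eqmodN_sym eqmodN_trans.

(* Z / Nord Z; the library's ['Z_n] is not used as it is wrong for n = 1. *)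
Definition ZmodN : Type := {eq_quot eqmodN_equiv}.
HB.instance Definition _ := Choice.on ZmodN.
HB.instance Definition _ : EqQuotient int eqmodN_equiv ZmodN := EqQuotient.on ZmodN.

Definition shadow : Type := ZmodN * quotient NF2.

Definition shadow_class (m : int) (f : F2) : shadow :=
  (\pi_ZmodN m, \pi_(quotient NF2) f).

Definition hexagons (m : int) (f' : F2) : Prop :=
  let f : B3 := val f' in
  let e := (2 * m + 1)%R in
  \pi_(quotient N) (zexp sigma1 e * f^-1 * zexp sigma2 e * f) =
  \pi_(quotient N) (f^-1 * sigma1 * sigma2 * zexp x12 (- m)%R * zexp cc m) /\
  \pi_(quotient N) (f^-1 * zexp sigma2 e * f * zexp sigma1 e) =
  \pi_(quotient N) (sigma2 * sigma1 * zexp x23 (- m)%R * zexp cc m * f).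

(* A homomorphism once the hexagon relations hold. *)
Definition Tmf (m : int) (f : F2) : B3 -> quotient N :=
  let e := (2 * m + 1)%R in
  braid_hom (\pi_(quotient N) (zexp sigma1 e))
            (\pi_(quotient N) ((val f)^-1 * zexp sigma2 e * val f)).

Definition is_GT_shadow (m : int) (f : F2) : Prop :=
  [/\ hexagons m f,
      coprimez (2 * m + 1)%R (Nord : int),
      derived_subgroup (quotient NF2) (\pi_(quotient NF2) f) &
      range (Tmf m f) = setT].

Definition GT : set shadow :=
  [set q | exists m f, q = shadow_class m f /\ is_GT_shadow m f].

End GTShadows.
Arguments GT N : clear implicits.
Arguments shadow_class N m f : clear implicits.
Arguments is_GT_shadow N m f : clear implicits.
Arguments Tmf N m f : clear implicits.

(* Morphisms from K to N in the groupoid GTSh. Their composition is not needed to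
   define its connected components. *)
Definition GTSh_hom (K N : NFI) : set (shadow N) :=
  [set q | exists m f, [/\ q = shadow_class N m f, is_GT_shadow N m f &
                           [set x | Tmf N m f x = 1] = subgroup_set K]].
Arguments GTSh_hom K N : clear implicits.

(* The equivalence relation on objects generated by the existence of a morphism. *)
Definition GTSh_connected : NFI -> NFI -> Prop :=
  clos_refl_sym_trans NFI (fun K N => GTSh_hom K N !=set0).

Definition isolated (N : NFI) : Prop := forall K : NFI, GTSh_connected K N -> K = N.

(* Schreier rewriting for PB3, with values in a group in which a, b and c are the
   images of x12, x23 and cc. *)
Variant transversal := Te | Ts1 | Ts2 | Ts12 | Ts21 | Ts121.

Definition trep (G : groupType) (s t : G) (x : transversal) : G :=
  match x with
  | Te => 1 | Ts1 => s | Ts2 => t | Ts12 => s * t | Ts21 => t * s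
  | Ts121 => s * t * s
  end.

Definition tstep (i : bool) (x : transversal) : transversal :=
  match i, x with
  | false, Te => Ts1 | false, Ts1 => Te | false, Ts2 => Ts21
  | false, Ts12 => Ts121 | false, Ts21 => Ts2 | false, Ts121 => Ts12
  | true, Te => Ts2 | true, Ts1 => Ts12 | true, Ts2 => Te
  | true, Ts12 => Ts1 | true, Ts21 => Ts121 | true, Ts121 => Ts21
  end.

Section Schreier.
Variables (H : groupType) (a b c : H).
Hypotheses (ac : commute a c) (bc : commute b c).

Definition tcost (i : bool) (x : transversal) : H :=
  match i, x with
  | false, Ts1 => a | false, Ts21 => a^-1 * c * b^-1 | false, Ts121 => b
  | true, Ts2 => b | true, Ts12 => b^-1 * a^-1 * c | true, Ts121 => a
  | _, _ => 1
  end.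

Definition tmove (l : bool * bool) (x : transversal * H) : transversal * H :=
  (tstep l.1 x.1,
   x.2 * if l.2 then (tcost l.1 (tstep l.1 x.1))^-1 else tcost l.1 x.1).

Definition trun (w : word bool) (x : transversal * H) := foldl (fun y l => tmove l y) x w.

Lemma trun_eq u v : word_eq braid_relation u v -> trun u =1 trun v.
Proof.
elim=> {u v} //.
- by move=> u v _ E x; rewrite E.
- by move=> u v w _ E1 _ E2 x; rewrite E1.
- by move=> u u' v v' _ E1 _ E2 x; rewrite /trun !foldl_cat -!/(trun _ _) E1 E2.
- move=> [] [] [x h]; rewrite /trun /tmove /=; congr (_, _); case: x => //=;
  by rewrite ?(mulgK, mulgVK).
move=> u v; rewrite inE => /eqP[-> ->] [x h]; rewrite /trun /tmove /=.
congr (_, _); first by case: x.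
case: x => /=; rewrite ?mulg1 //.
- rewrite !mulgA mulgK -[RHS]mulgA -ac mulgA mulgVK -!mulgA; congr (_ * _).
  exact/commute_sym/commute_sym/commuteV/commute_sym.
- by rewrite !mulgA mulgK mulgVK.
- by rewrite !mulgA !mulgK mulgVK -[LHS]mulgA -ac mulgA mulgVK.
Qed.

(* The transversal representative and the PB3-part of g, starting from x. *)
Definition sch (g : B3) (x : transversal * H) : transversal * H := trun (repr g) x.

Lemma sch_pi (w : word bool) x : sch (\pi_(presented braid_relation) w : B3) x = trun w x.
Proof. exact/trun_eq/presented_repr. Qed.

Lemma schM g h x : sch (g * h) x = sch h (sch g x).
Proof.
rewrite -[g]reprK -[h]reprK; move: (repr g) (repr h) => u v.
rewrite (presented_piM braid_relation u v) sch_pi /trun foldl_cat -!/(trun _ _).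
by rewrite !sch_pi.
Qed.

Lemma sch1 x : sch 1 x = x.
Proof. exact: (sch_pi [::]). Qed.

Lemma sch_sigma1 x : sch sigma1 x = (tstep false x.1, x.2 * tcost false x.1).
Proof. exact: (sch_pi [:: (false, false)]). Qed.
Lemma sch_sigma2 x : sch sigma2 x = (tstep true x.1, x.2 * tcost true x.1).
Proof. exact: (sch_pi [:: (true, false)]). Qed.
Lemma sch_sigma1V x : sch sigma1^-1 x =
  (tstep false x.1, x.2 * (tcost false (tstep false x.1))^-1).
Proof.
have -> : sigma1^-1 = \pi_(presented braid_relation) [:: (false, true)] :> B3.
  exact: (presented_pi_inv braid_relation [:: (false, false)]).
exact: sch_pi.
Qed.
Lemma sch_sigma2V x : sch sigma2^-1 x =
  (tstep true x.1, x.2 * (tcost true (tstep true x.1))^-1).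
Proof.
have -> : sigma2^-1 = \pi_(presented braid_relation) [:: (true, true)] :> B3.
  exact: (presented_pi_inv braid_relation [:: (true, false)]).
exact: sch_pi.
Qed.
Definition schE := (sch_sigma1, sch_sigma2, sch_sigma1V, sch_sigma2V).

Lemma sch_mull g h x : sch g (x.1, h * x.2) = ((sch g x).1, h * (sch g x).2).
Proof.
elim/B3_ind: g => [|g IH|g IH|g IH|g IH].
  by rewrite !sch1.
all: by rewrite !schM IH !schE /= mulgA.
Qed.

Lemma sch_mul g t h : sch g (t, h) = ((sch g (t, 1)).1, h * (sch g (t, 1)).2).
Proof. by rewrite -sch_mull /= mulg1. Qed.

Definition tperm_of : transversal -> 'S_3 :=
  trep (tperm (inord 0) (inord 1)) (tperm (inord 1) (inord 2)).

Lemma sch_perm g x : tperm_of (sch g x).1 = tperm_of x.1 * braid_perm g.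
Proof.
have st := tperm_braid; have s2 := tperm2 (inord 0 : 'I_3) (inord 1).
have t2 := tperm2 (inord 1 : 'I_3) (inord 2).
have pM : {morph braid_perm : x y / x * y} := braid_homM tperm_braid.
have pV : {morph braid_perm : x / x^-1} := braid_homV tperm_braid.
have p1 : braid_perm sigma1 = _ := braid_hom_sigma1 tperm_braid.
have p2 : braid_perm sigma2 = _ := braid_hom_sigma2 tperm_braid.
have [E1 E2] : (forall y, tperm_of (tstep false y) = tperm_of y * braid_perm sigma1) /\
    (forall y, tperm_of (tstep true y) = tperm_of y * braid_perm sigma2).
  rewrite p1 p2 /tperm_of; move: st s2 t2 => /=.
  set s := tperm _ _; set t := tperm _ _ => st s2 t2.
  split; case => //=; rewrite ?mul1g ?mulg1 // -?mulgA ?s2 ?t2 ?mulg1 //.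
  by rewrite !mulgA st -!mulgA t2 mulg1.
have V1 : braid_perm sigma1^-1 = braid_perm sigma1 by rewrite pV p1 tpermV.
have V2 : braid_perm sigma2^-1 = braid_perm sigma2 by rewrite pV p2 tpermV.
elim/B3_ind: g => [|g IH|g IH|g IH|g IH].
  by rewrite sch1 [braid_perm 1](braid_hom1 tperm_braid) mulg1.
all: by rewrite schM schE /= ?E1 ?E2 IH pM ?V1 ?V2 mulgA.
Qed.

Lemma tperm_of1 x : tperm_of x = 1 -> x = Te.
Proof.
have [e0 e1 e2] : [/\ inord 0 = @Ordinal 3 0 isT,
  inord 1 = @Ordinal 3 1 isT & inord 2 = @Ordinal 3 2 isT].
  by split; apply: val_inj; rewrite /= inordK.
rewrite /tperm_of e0 e1 e2; case: x => //= /permP E.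
- by have := E (Ordinal (isT : 0 < 3)); do ?rewrite permE /=.
- by have := E (Ordinal (isT : 1 < 3)); do ?rewrite permE /=.
- by have := E (Ordinal (isT : 0 < 3)); do ?rewrite permE /=.
- by have := E (Ordinal (isT : 0 < 3)); do ?rewrite permE /=.
- by have := E (Ordinal (isT : 0 < 3)); do ?rewrite permE /=.
Qed.

Lemma sch_pure g : PB3 g -> (sch g (Te, 1)).1 = Te.
Proof. by move=> pg; apply: tperm_of1; rewrite sch_perm pg mulg1. Qed.

Definition schPB (g : B3) : H := (sch g (Te, 1)).2.

Lemma schPB_M g h : PB3 g -> schPB (g * h) = schPB g * schPB h.
Proof.
move=> pg; rewrite /schPB schM [sch g _]surjective_pairing sch_pure //.
by rewrite sch_mul.
Qed.

Lemma schPB_x12 : schPB x12 = a.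
Proof. by rewrite /schPB /x12 expg2 schM !schE /= !mul1g. Qed.
Lemma schPB_x23 : schPB x23 = b.
Proof. by rewrite /schPB /x23 expg2 schM !schE /= !mul1g. Qed.
Lemma schPB_cc : schPB cc = c.
Proof.
rewrite /schPB /cc expg2 !schM !schE /= !mul1g !mulgA mulgV mul1g.
by rewrite -mulgA -ac mulKg.
Qed.

End Schreier.

Section PB3Generation.

Local Notation s := sigma1.
Local Notation t := sigma2.
Local Notation st := braidE.

Lemma cc_sigma1 : commute sigma1 cc.
Proof.
rewrite /commute /cc expg2.
have d1 : s * (s * t * s) = (s * t * s) * t by rewrite {1}st !mulgA.
have d2 : t * (s * t * s) = (s * t * s) * s by rewrite {2}st !mulgA.
by rewrite mulgA d1 -mulgA d2 mulgA.
Qed.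

Lemma cc_sigma2 : commute sigma2 cc.
Proof.
rewrite /commute /cc expg2.
have d1 : s * (s * t * s) = (s * t * s) * t by rewrite {1}st !mulgA.
have d2 : t * (s * t * s) = (s * t * s) * s by rewrite {2}st !mulgA.
by rewrite mulgA d2 -mulgA d1 mulgA.
Qed.

Lemma cc_x12 : commute x12 cc.
Proof. exact/commute_sym/commuteX/commute_sym/cc_sigma1. Qed.
Lemma cc_x23 : commute x23 cc.
Proof. exact/commute_sym/commuteX/commute_sym/cc_sigma2. Qed.

Lemma cc1 : cc = s * (t * t) * s * (t * t).
Proof.
rewrite /cc expg2 {2}st.
have -> : s * (t * t) * s * (t * t) = s * t * (t * s * t) * t by rewrite !mulgA.
by rewrite -[X in _ = s * t * X * t]st !mulgA.
Qed.

Lemma cc2 : cc = s * s * t * (s * s) * t.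
Proof.
rewrite /cc expg2 {2}st.
have -> : s * s * t * (s * s) * t = s * (s * t * s) * (s * t) by rewrite !mulgA.
by rewrite [X in s * X * (s * t)]st !mulgA.
Qed.

Lemma x23_sigma1 : x23^-1 * x12^-1 * cc * sigma1 = sigma1 * x23.
Proof.
rewrite -(mulgA _ cc) -cc_sigma1 cc1 /x12 /x23 !expg2 !invgM !mulgA.
by rewrite !mulgVK mulVg mul1g.
Qed.

Lemma x12_sigma2 : x12^-1 * cc * x23^-1 * sigma2 = sigma2 * x12.
Proof.
rewrite cc2 /x12 /x23 !expg2 !invgM !mulgA.
by rewrite !(mulgVK, mulgK) mulVg mul1g.
Qed.

Lemma delta_sigma1 : x23 * (s * t) = s * t * s * s.
Proof.
have -> : s * t * s * s = t * (s * t * s) by rewrite [in LHS]st !mulgA.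
by rewrite st /x23 expg2 !mulgA.
Qed.

Lemma delta_sigma2 : x12 * (t * s) = s * t * s * t.
Proof.
have -> : s * t * s * t = s * (t * s * t) by rewrite !mulgA.
by rewrite -st /x12 expg2 !mulgA.
Qed.

Lemma sch_trep g (x : transversal * B3) :
  let y := sch x12 x23 cc g x in
  y.2 * trep s t y.1 = x.2 * trep s t x.1 * g.
Proof.
have E1 h : tcost x12 x23 cc false h * trep s t (tstep false h) = trep s t h * s.
  case: h => /=; rewrite ?mul1g ?mulg1 //.
    by rewrite [LHS]x12_sigma2 /x12 expg2 mulgA.
  exact: delta_sigma1.
have E2 h : tcost x12 x23 cc true h * trep s t (tstep true h) = trep s t h * t.
  case: h => /=; rewrite ?mul1g ?mulg1 //.
    by rewrite [LHS]x23_sigma1 /x23 expg2 mulgA.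
    exact: braidE.
  exact: delta_sigma2.
have F1 : forall h, (tcost x12 x23 cc false (tstep false h))^-1 *
    trep s t (tstep false h) = trep s t h * s^-1.
  move=> h; apply: (@mulgI _ (tcost x12 x23 cc false (tstep false h))).
  rewrite mulgA mulgV mul1g mulgA; apply: (@mulIg _ s); rewrite mulgVK -E1.
  by congr (_ * _); case: h.
have F2' : forall h, (tcost x12 x23 cc true (tstep true h))^-1 *
    trep s t (tstep true h) = trep s t h * t^-1.
  move=> h; apply: (@mulgI _ (tcost x12 x23 cc true (tstep true h))).
  rewrite mulgA mulgV mul1g mulgA; apply: (@mulIg _ t); rewrite mulgVK -E2.
  by congr (_ * _); case: h.
elim/B3_ind: g x => [|g IH|g IH|g IH|g IH] x /=; first by rewrite (sch1 cc_x12 cc_x23) mulg1.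
all: rewrite (schM cc_x12 cc_x23) !(schE cc_x12 cc_x23) /=.
all: by rewrite -mulgA ?E1 ?E2 ?F1 ?F2' mulgA IH !mulgA.
Qed.

Lemma sch_generated g x : generated [set x12; x23; cc] x.2 ->
  generated [set x12; x23; cc] (sch x12 x23 cc g x).2.
Proof.
pose P := generated_subgroup [set x12; x23; cc].
have Pa : P x12 by apply: sub_gen_smallest; left; left.
have Pb : P x23 by apply: sub_gen_smallest; left; right.
have Pc : P cc by apply: sub_gen_smallest; right.
have P1 : P 1 := subgroup1 P.
have PM := @subgroupM _ P; have PV := @subgroupV _ P.
have Pt i h : P (tcost x12 x23 cc i h).
  have Pu : P (x23^-1 * x12^-1 * cc) by exact: (PM _ _ (PM _ _ (PV _ Pb) (PV _ Pa)) Pc).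
  have Pv : P (x12^-1 * cc * x23^-1) 
    by exact: (PM _ _ (PM _ _ (PV _ Pa) Pc) (PV _ Pb)).
  by case: i; case: h.
rewrite -!/(P _); elim/B3_ind: g x => [|g IH|g IH|g IH|g IH] x Px.
  by rewrite (sch1 cc_x12 cc_x23).
all: rewrite (schM cc_x12 cc_x23) !(schE cc_x12 cc_x23).
- exact: (PM _ _ (IH _ Px) (Pt false _)).
- exact: (PM _ _ (IH _ Px) (Pt true _)).
- exact: (PM _ _ (IH _ Px) (PV _ (Pt false (tstep false _)))).
- exact: (PM _ _ (IH _ Px) (PV _ (Pt true (tstep true _)))).
Qed.

Lemma PB3_generated : PB3 `<=` generated [set x12; x23; cc].
Proof.
move=> g pg; have := sch_trep g (Te, 1); rewrite /= !mul1g.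
rewrite (sch_pure cc_x12 cc_x23 pg) /= mulg1 => <-.
by apply: sch_generated; apply: (subgroup1 (generated_subgroup _)).
Qed.

End PB3Generation.

Lemma braid_permM : {morph braid_perm : x y / x * y}.
Proof. exact: braid_homM tperm_braid. Qed.
Lemma braid_permV : {morph braid_perm : x / x^-1}.
Proof. exact: braid_homV tperm_braid. Qed.

Lemma PB3_closed : group_closed (mem PB3).
Proof.
apply: group_closedP => [|x y|x]; rewrite /PB3 /=.
- exact: braid_hom1 tperm_braid.
- by rewrite braid_permM => -> ->; rewrite mulg1.
- by rewrite braid_permV => ->; rewrite invg1.
Qed.

Lemma PB3_conj x g : PB3 x -> PB3 (x ^ g).
Proof.
rewrite /PB3 /= conjgE !braid_permM braid_permV => ->.
by rewrite mul1g mulVg.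
Qed.

Lemma PB3_x12 : PB3 x12.
Proof.
by rewrite /PB3 /= /x12 expg2 braid_permM [braid_perm _](braid_hom_sigma1 tperm_braid) tperm2.
Qed.
Lemma PB3_x23 : PB3 x23.
Proof.
by rewrite /PB3 /= /x23 expg2 braid_permM [braid_perm _](braid_hom_sigma2 tperm_braid) tperm2.
Qed.
Lemma PB3_cc : PB3 cc.
Proof.
have -> : cc = sigma1 * x23 * sigma1 * x23 by exact: cc1.
have E : braid_perm x23 = 1 := PB3_x23.
rewrite /PB3 /mkset (braid_permM _ x23) (braid_permM _ sigma1) (braid_permM _ x23).
by rewrite E !mulg1 -braid_permM; exact: PB3_x12.
Qed.

(* A homomorphism on PB3 is determined by its values at x12, x23 and cc. *)
Lemma PB3_hom_eq (H : groupType) (f g : B3 -> H) :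
  (forall x y, PB3 x -> PB3 y -> f (x * y) = f x * f y) ->
  (forall x y, PB3 x -> PB3 y -> g (x * y) = g x * g y) ->
  f x12 = g x12 -> f x23 = g x23 -> f cc = g cc ->
  forall x, PB3 x -> f x = g x.
Proof.
move=> fM gM E1 E2 E3 x /PB3_generated.
pose PB := Subgroup PB3_closed.
have one (h : B3 -> H) : (forall x y, PB3 x -> PB3 y -> h (x * y) = h x * h y) -> h 1 = 1.
  move=> hM; apply: (@mulgI _ (h 1)); rewrite mulg1 -hM ?mulg1 //;
  exact: (subgroup1 PB).
have inv (h : B3 -> H) y : (forall x y, PB3 x -> PB3 y -> h (x * y) = h x * h y) ->
    PB3 y -> h y^-1 = (h y)^-1.
  move=> hM py; apply: (@mulgI _ (h y)); rewrite -hM ?mulgV ?one //.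
  exact: (@subgroupV _ PB).
have clE : group_closed (mem [set x | PB3 x /\ f x = g x]).
  apply: group_closedP => [|y z [py Ey] [pz Ez]|y [py Ey]]; split.
  - exact: (subgroup1 PB).
  - by rewrite !one.
  - exact: (@subgroupM _ PB).
  - by rewrite fM // gM // Ey Ez.
  - exact: (@subgroupV _ PB).
  - by rewrite !inv // Ey.
suff sub : generated [set x12; x23; cc] `<=` [set x | PB3 x /\ f x = g x].
  by move=> /sub[].
apply: smallest_sub => // y [[->|->]|->]; split=> //;
  [exact: PB3_x12|exact: PB3_x23|exact: PB3_cc].
Qed.

(* F2 being free on x12 and x23, and PB3 being the direct product of F2 and <cc>,
   homomorphisms from PB3 trivial on cc can be prescribed at x12 and x23. *)
Lemma PB3_hom_exists (H : groupType) (a b : H) :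
  exists f : B3 -> H,
    [/\ forall x y, PB3 x -> PB3 y -> f (x * y) = f x * f y,
        f x12 = a, f x23 = b & f cc = 1].
Proof.
have a1 : commute a 1 by exact: commute1.
have b1 : commute b 1 by exact: commute1.
exists (schPB a b 1); split.
- by move=> x y px _; apply: schPB_M.
- exact: schPB_x12.
- exact: schPB_x23.
- exact: schPB_cc.
Qed.

(* Relations r^n = 1, s^2 = 1 and s r s^-1 r = 1 between the generators
   r = [false] and s = [true]. *)
Definition dihedral_relations (n : nat) : seq (word bool * word bool) :=
  let r := (false, false) in let s := (true, false) in let sV := (true, true) in
  [:: (nseq n r, [::]); ([:: s; s], [::]); ([:: s; r; sV; r], [::])].

Definition D (n : nat) : groupType := presented (dihedral_relations n).
Definition rr (n : nat) : D n := gen (dihedral_relations n) false.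
Definition ss (n : nat) : D n := gen (dihedral_relations n) true.

Definition D3 (n : nat) : groupType := (D n * D n * D n)%type.

Section Dihedral.
Variable n : nat.
Local Notation r := (rr n).
Local Notation s := (ss n).

Lemma dihedral_hom_exists (H : groupType) (a b : H) :
  a ^+ n = 1 -> b * b = 1 -> b * a = a^-1 * b ->
  exists f : D n -> H, [/\ {morph f : x y / x * y}, f r = a & f s = b].
Proof.
move=> an bb ba; pose h i := if i then b else a.
have hR u v : (u, v) \in dihedral_relations n -> word_val h u = word_val h v.
  have E k : word_val h (nseq k (false, false)) = a ^+ k.
    rewrite /word_val; elim: k => [|k IH]; first by rewrite big_nil.
    by rewrite big_cons /= IH expgS.
  rewrite !inE => /or3P[] /eqP[-> ->]; rewrite ?E // /word_val ?big_cons ?big_nil /= ?mulg1.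
  - exact: an.
  - by [].
  - by rewrite mulgA ba -mulgA mulVKg mulVg.
exists (presented_hom h); split.
- exact: presented_hom_morph.
- exact: (presented_hom_gen hR false).
- exact: (presented_hom_gen hR true).
Qed.

Lemma rrX : r ^+ n = 1.
Proof.
have E k : r ^+ k = \pi_(presented (dihedral_relations n)) (nseq k (false, false)) :> D n.
  elim: k => [//|k IH]; rewrite expgS IH; exact: (presented_piM _ [:: _]).
by rewrite E; apply/presented_eq/word_eq_rel; rewrite !inE eqxx.
Qed.

Lemma ssM : s * s = 1.
Proof.
rewrite /ss /gen [LHS](presented_piM (dihedral_relations n) [:: _] [:: _]).
by apply/presented_eq/word_eq_rel; rewrite !inE eqxx orbT.
Qed.

Lemma ssV : s^-1 = s. Proof. by apply: mulg1_eq; rewrite ssM. Qed.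

Lemma ssr : s * r = r^-1 * s.
Proof.
suff E : s * r * s^-1 * r = 1.
  by apply: (@mulIg _ s^-1); rewrite mulgK; apply: (@mulIg _ r); rewrite E mulVg.
have -> : s^-1 = \pi_(presented (dihedral_relations n)) [:: (true, true)] :> D n.
  exact: (presented_pi_inv (dihedral_relations n) [:: (true, false)]).
have M := presented_piM (dihedral_relations n).
rewrite /ss /rr /gen [X in X * _ * _]M [X in X * _]M [LHS]M.
by apply/presented_eq/word_eq_rel; rewrite !inE eqxx !orbT.
Qed.

Lemma ssrV : s * r^-1 = r * s.
Proof. by apply: (@mulIg _ r); rewrite mulgVK -mulgA ssr mulgA mulgV mul1g. Qed.

(* Normalisation of left-associated products to the form r^i s^b. *)
Lemma ssrA x : x * s * r = x * r^-1 * s.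
Proof. by rewrite -mulgA ssr mulgA. Qed.
Lemma ssrVA x : x * s * r^-1 = x * r * s.
Proof. by rewrite -mulgA ssrV mulgA. Qed.
Lemma ssMA x : x * s * s = x.
Proof. by rewrite -mulgA ssM mulg1. Qed.
Definition dnf := (@invgM (D n), @invgK (D n), @mulgA (D n), @mulg1 (D n), @mul1g (D n),
  (ssrA, ssrVA, ssMA, @mulgK (D n), @mulgVK (D n)),
  (ssV, ssr, ssrV, ssM, @mulVg (D n), @mulgV (D n))).

Lemma dihedral_endo (a b : D n) :
  a ^+ n = 1 -> b * b = 1 -> b * a = a^-1 * b ->
  exists f : D n -> D n, [/\ {morph f : x y / x * y}, f r = a & f s = b].
Proof. exact: dihedral_hom_exists. Qed.

Lemma rrVX : r^-1 ^+ n = 1. Proof. by rewrite expVgn rrX invg1. Qed.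

Lemma dihedral_elt (n0 : (0 < n)%N) (x : D n) : exists (i : 'I_n) (b : bool), x = r ^+ i * s ^+ b.
Proof.
suff [i [b ->]] : exists (i : nat) (b : bool), x = r ^+ i * s ^+ b.
  exists (Ordinal (ltn_pmod i n0)), b; congr (_ * _).
  rewrite {1}(divn_eq i n) expgnDr mulnC expgnA rrX expg1n mul1g //.
have rV : r^-1 = r ^+ n.-1.
  by apply: mulg1_eq; rewrite -expgS prednK // rrX.
elim/presented_ind: x => [|x g|x g].
- by exists 0%N, false; rewrite mulg1.
- move=> [i [b ->]]; case: g; rewrite -?/s -?/r; case: b; rewrite /= -mulgA.
  + by exists i, false; rewrite ssM.
  + by exists i, true; rewrite mul1g.
  + by exists (i + n.-1)%N, true; rewrite expg1 ssr rV mulgA expgnDr.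
  + by exists i.+1, false; rewrite mulg1 mul1g expgSr.
- move=> [i [b ->]]; case: g; rewrite -?/s -?/r ?ssV; case: b; rewrite /= -mulgA.
  + by exists i, false; rewrite ssM.
  + by exists i, true; rewrite mul1g.
  + by exists i.+1, true; rewrite expg1 ssrV mulgA expgSr.
  + by exists (i + n.-1)%N, false; rewrite mulg1 mul1g rV expgnDr.
Qed.

Lemma dihedral_finite : (0 < n)%N -> finite_set [set: D n].
Proof.
move=> n0; apply: (@sub_finite_set _ _ (range (fun p : 'I_n * bool => r ^+ p.1 * s ^+ p.2))).
  by move=> x _; have [i [b ->]] := dihedral_elt n0 x; exists (i, b).
exact/finite_image/finite_finset.
Qed.

End Dihedral.

Lemma psi_exists (n : nat) : exists f : B3 -> D3 n,
  [/\ forall x y, PB3 x -> PB3 y -> f (x * y) = f x * f y,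
      f x12 = (rr n, ss n, ss n), f x23 = (rr n * ss n, rr n, rr n * ss n) & f cc = 1].
Proof. exact: PB3_hom_exists. Qed.

(* The homomorphism psi_n from PB3 to D_n^3, extended arbitrarily to B3; it is
   characterised on PB3 by [psi_exists] and [PB3_hom_eq]. *)
Definition psi (n : nat) : B3 -> D3 n := sval (cid (psi_exists n)).

Section Kn.
Variable n : nat.
Local Notation r := (rr n).
Local Notation s := (ss n).

Lemma psiM x y : PB3 x -> PB3 y -> psi n (x * y) = psi n x * psi n y.
Proof. by rewrite /psi; case: cid => f [] /= ? *; auto. Qed.
Lemma psi_x12 : psi n x12 = (r, s, s).
Proof. by rewrite /psi; case: cid => f []. Qed.
Lemma psi_x23 : psi n x23 = (r * s, r, r * s).
Proof. by rewrite /psi; case: cid => f []. Qed.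
Lemma psi_cc : psi n cc = 1.
Proof. by rewrite /psi; case: cid => f []. Qed.

Lemma psi1 : psi n 1 = 1.
Proof.
apply: (@mulgI _ (psi n 1)); rewrite mulg1 -psiM ?mulg1 //;
exact: (subgroup1 (Subgroup PB3_closed)).
Qed.
Lemma psiV x : PB3 x -> psi n x^-1 = (psi n x)^-1.
Proof.
move=> px; apply: (@mulgI _ (psi n x)); rewrite -psiM ?mulgV ?psi1 //.
exact: (@subgroupV _ (Subgroup PB3_closed)).
Qed.

Definition Kn_set : set B3 := [set x | PB3 x /\ psi n x = 1].

Lemma Kn_closed : group_closed (mem Kn_set).
Proof.
pose PB := Subgroup PB3_closed.
apply: group_closedP => [|x y [px Ex] [py Ey]|x [px Ex]]; split.
- exact: (subgroup1 PB).
- exact: psi1.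
- exact: (@subgroupM _ PB).
- by rewrite psiM // Ex Ey mulg1.
- exact: (@subgroupV _ PB).
- by rewrite psiV // Ex invg1.
Qed.

Lemma Kn_conj_gen (g : B3) (p : D3 n -> D3 n) (e1 e2 e3 : D n -> D n) :
  commute g cc -> {morph p : x y / x * y} ->
  {morph e1 : x y / x * y} -> {morph e2 : x y / x * y} -> {morph e3 : x y / x * y} ->
  let e (d : D3 n) : D3 n := (e1 (p d).1.1, e2 (p d).1.2, e3 (p d).2) in
  psi n (x12 ^ g) = e (psi n x12) -> psi n (x23 ^ g) = e (psi n x23) ->
  forall x, Kn_set x -> Kn_set (x ^ g).
Proof.
move=> gc pM e1M e2M e3M e E1 E2 x [px Ex]; split; first exact: PB3_conj.
have eM : {morph e : x y / x * y} by move=> d d'; rewrite /e pM /= e1M e2M e3M.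
have e11 : e 1 = 1 by apply: (@mulgI _ (e 1)); rewrite -eM !mulg1.
rewrite -e11 -Ex; apply: (@PB3_hom_eq _ (fun y => psi n (y ^ g)) (e \o psi n)) => //.
- by move=> y z py pz; rewrite conjMg psiM //; apply: PB3_conj.
- by move=> y z py pz; rewrite /= psiM.
- by rewrite /= psi_cc e11 conjgE -gc mulKg psi_cc.
Qed.

Let PB := Subgroup PB3_closed.

Lemma psi_u : psi n (x23^-1 * x12^-1 * cc) = (r * r * s, r^-1 * s, r).
Proof.
have [pa pb pc] : [/\ PB x12, PB x23 & PB cc] by split; [exact: PB3_x12|exact: PB3_x23|exact: PB3_cc].
rewrite psiM; [|by apply: (@subgroupM _ PB); exact: subgroupV|by []].
rewrite psiM; [|exact: (@subgroupV _ PB)|exact: (@subgroupV _ PB)].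
rewrite !psiV // psi_x12 psi_x23 psi_cc mulg1.
by congr (_, _, _) => /=; rewrite !dnf.
Qed.

Lemma psi_v : psi n (x12^-1 * cc * x23^-1) = (s, r * s, r^-1).
Proof.
have [pa pb pc] : [/\ PB x12, PB x23 & PB cc] by split; [exact: PB3_x12|exact: PB3_x23|exact: PB3_cc].
rewrite psiM; [|by apply: (@subgroupM _ PB) => //; exact: subgroupV|exact: (@subgroupV _ PB)].
rewrite psiM; [|exact: (@subgroupV _ PB)|by []].
rewrite !psiV // psi_x12 psi_x23 psi_cc mulg1.
by congr (_, _, _) => /=; rewrite !dnf.
Qed.

Lemma x23_conj1V : x23 ^ sigma1^-1 = x23^-1 * x12^-1 * cc.
Proof. by rewrite conjgE invgK mulgA -x23_sigma1 mulgK. Qed.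
Lemma x12_conj2V : x12 ^ sigma2^-1 = x12^-1 * cc * x23^-1.
Proof. by rewrite conjgE invgK mulgA -x12_sigma2 mulgK. Qed.
Lemma x23_conj1 : x23 ^ sigma1 = x12^-1 * cc * x23^-1.
Proof.
rewrite -x12_conj2V !conjgE invgK; apply: (@mulgI _ sigma1); rewrite mulVKg.
apply: (@mulIg _ sigma2); rewrite -[LHS]mulgA delta_sigma1.
by rewrite -[RHS]mulgA -(mulgA sigma2) mulgVK /x12 expg2 !mulgA.
Qed.
Lemma x12_conj2 : x12 ^ sigma2 = x23^-1 * x12^-1 * cc.
Proof.
rewrite -x23_conj1V !conjgE invgK; apply: (@mulgI _ sigma2); rewrite mulVKg.
apply: (@mulIg _ sigma1); rewrite -[LHS]mulgA delta_sigma2.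
by rewrite -[RHS]mulgA -[in RHS](mulgA sigma1) mulgVK /x23 expg2 !mulgA [in LHS]braidE.
Qed.

Lemma Kn_normal x g : Kn_set x -> Kn_set (x ^ g).
Proof.
have cV (a b : B3) : commute a b -> commute a^-1 b.
  by move=> ab; apply/commute_sym/commuteV/commute_sym.
have [phi [phiM phir phis]] : exists f : D n -> D n,
    [/\ {morph f : x y / x * y}, f r = r & f s = r * s].
  by apply: dihedral_endo; rewrite ?rrX // !dnf.
have [phi' [phi'M phi'r phi's]] : exists f : D n -> D n,
    [/\ {morph f : x y / x * y}, f r = r & f s = r^-1 * s].
  by apply: dihedral_endo; rewrite ?rrX // !dnf.
have [iota [iotaM iotar iotas]] : exists f : D n -> D n,
    [/\ {morph f : x y / x * y}, f r = r^-1 & f s = s].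
  by apply: dihedral_endo; rewrite ?rrVX // !dnf.
have [kap [kapM kapr kaps]] : exists f : D n -> D n,
    [/\ {morph f : x y / x * y}, f r = r^-1 & f s = r * r * s].
  by apply: dihedral_endo; rewrite ?rrVX // !dnf.
have idM : {morph (@idfun (D n)) : x y / x * y} by [].
pose p23 (d : D3 n) : D3 n := (d.1.1, d.2, d.1.2).
pose p13 (d : D3 n) : D3 n := (d.2, d.1.2, d.1.1).
have p23M : {morph p23 : x y / x * y} by [].
have p13M : {morph p13 : x y / x * y} by [].
have x1 : x12 ^ sigma1 = x12 by rewrite /x12 expg2 conjgE !mulgA mulVg mul1g.
have x2 : x23 ^ sigma2 = x23 by rewrite /x23 expg2 conjgE !mulgA mulVg mul1g.
have x1' : x12 ^ sigma1^-1 = x12 by rewrite -{1}x1 conjgK.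
have x2' : x23 ^ sigma2^-1 = x23 by rewrite -{1}x2 conjgK.
have K1 := @Kn_conj_gen sigma1 p23 phi' idfun iota cc_sigma1 p23M phi'M idM iotaM.
have K1' := @Kn_conj_gen sigma1^-1 p23 phi iota idfun (cV _ _ cc_sigma1) p23M phiM iotaM idM.
have K2 := @Kn_conj_gen sigma2 p13 kap phi' idfun cc_sigma2 p13M kapM phi'M idM.
have K2' := @Kn_conj_gen sigma2^-1 p13 idfun phi kap (cV _ _ cc_sigma2) p13M idM phiM kapM.
elim/B3_ind: g => [|g IH|g IH|g IH|g IH] Kx; first by rewrite conjg1.
all: rewrite conjgM.
- apply: K1 (IH Kx).
  + by rewrite x1 psi_x12 /p23 /= phi'r iotas.
  + by rewrite x23_conj1 psi_v psi_x23 /p23 /= phi'M phi'r phi's iotar !dnf.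
- apply: K2 (IH Kx).
  + by rewrite x12_conj2 psi_u psi_x12 /p13 /= kaps phi's.
  + by rewrite x2 psi_x23 /p13 /= kapM phi'r kapr kaps !dnf.
- apply: K1' (IH Kx).
  + by rewrite x1' psi_x12 /p23 /= phir iotas.
  + by rewrite x23_conj1V psi_u psi_x23 /p23 /= phiM phir phis iotaM iotar iotas !dnf.
- apply: K2' (IH Kx).
  + by rewrite x12_conj2V psi_v psi_x12 /p13 /= phis kapr.
  + by rewrite x2' psi_x23 /p13 /= phir kapM kapr kaps !dnf.
Qed.

Definition Kn_normal_subgroup : normal_subgroup B3 :=
  @NormalSubgroup B3 (Subgroup Kn_closed) Kn_normal.

Lemma Kn_finite_index : (0 < n)%N -> finite_set [set: quotient Kn_normal_subgroup].
Proof.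
move=> n0.
pose X := (rr n, ss n, ss n) : D3 n.
pose Y := (rr n * ss n, rr n, rr n * ss n) : D3 n.
have X1 : commute X 1 by exact: commute1.
have Y1 : commute Y 1 by exact: commute1.
pose F (g : B3) : 'S_3 * D3 n := (braid_perm g, schPB X Y 1 g).
have psiE : forall g, PB3 g -> psi n g = schPB X Y 1 g.
  apply: PB3_hom_eq.
  - by move=> x y; exact: psiM.
  - by move=> x y px _; apply: schPB_M.
  - by rewrite psi_x12 schPB_x12.
  - by rewrite psi_x23 schPB_x23.
  - by rewrite psi_cc schPB_cc.
have FE g h : F g = F h -> Kn_set (g * h^-1).
  case=> Ep Eh; have pu : PB3 (g * h^-1).
    by rewrite /PB3 /mkset braid_permM braid_permV Ep mulgV.
  split=> //; rewrite psiE //; apply: (@mulIg _ (schPB X Y 1 h)).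
  by rewrite -schPB_M // mulgVK mul1g.
have fin : finite_set [set: 'S_3 * D3 n].
  rewrite -!setXTT; apply: finite_setX; first exact: finite_finset.
  by do ![apply: finite_setX|exact: dihedral_finite].
have inj : {in [set: quotient Kn_normal_subgroup] &,
    injective (fun q : quotient Kn_normal_subgroup => F (repr q))}.
  move=> q1 q2 _ _ /FE; rewrite -{2}[q1]reprK -{2}[q2]reprK => Kq.
  apply/esym/quotient_eq; have := Kn_normal (repr q2) Kq.
  by rewrite conjgE mulgVK.
have -> : [set: quotient Kn_normal_subgroup] = (fun q => F (repr q)) @^-1` setT by [].
exact: finite_preimage inj fin.
Qed.

End Kn.

Definition Kn (n : nat) (hn : (3 <= n)%N) : NFI :=
  @MkNFI (Kn_normal_subgroup n) (fun x Kx => proj1 Kx)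
    (@Kn_finite_index n (leq_trans (isT : (0 < 3)%N) hn)).

Arguments Kn n hn : clear implicits.

Section Identification.
Variables (n : nat) (hn : (3 <= n)%N).
Local Notation K := (Kn n hn).

(* The identification of (Z / K_ord) x (F2 / K_F2) with a subset of Z x D_n^3:
   residues are represented in {0, ..., K_ord - 1}, and F2 / K_F2 is identified
   with a subgroup of D_n^3 through psi_n; see [identify_class], [identify_inj]. *)
Definition identify (q : shadow K) : int * D3 n :=
  ((repr q.1 %% (Nord K : int))%Z, psi n (val (repr q.2))).

Lemma F2_PB3 (f : F2) : PB3 (val f).
Proof.
have := set_mem (valP f); apply: smallest_sub; first exact: PB3_closed.
by move=> x [->|->]; [exact: PB3_x12|exact: PB3_x23].
Qed.

Lemma psi_F2 (f g : F2) : (psi n (val f) = psi n (val g)) <-> NF2 K (f^-1 * g).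
Proof.
have pV : PB3 (val f)^-1 := @subgroupV _ (Subgroup PB3_closed) _ (F2_PB3 f).
have E : psi n (val (f^-1 * g)) = (psi n (val f))^-1 * psi n (val g).
  by rewrite valF2_M valF2_V psiM ?psiV //; exact: F2_PB3.
split=> [fg|[_ /=]]; last by rewrite E => /mulg1_eq; rewrite invgK.
by split; [exact: F2_PB3|rewrite E fg mulVg].
Qed.

Lemma identify_class (m : int) (f : F2) :
  identify (shadow_class K m f) = ((m %% (Nord K : int))%Z, psi n (val f)).
Proof.
congr (_, _) => /=.
  apply/eqP; have : \pi_(ZmodN K) (repr (\pi_(ZmodN K) m)) = \pi_(ZmodN K) m.
    by rewrite reprK.
  by move=> /eqmodP.
apply/esym/psi_F2; exact: quotient_repr.
Qed.

Lemma identify_inj : injective identify.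
Proof.
move=> [a q] [b q'] [Em Ef]; congr (_, _).
  by rewrite -[a]reprK -[b]reprK; apply/eqmodP/eqP.
by rewrite -[q]reprK -[q']reprK; apply/quotient_eq/psi_F2.
Qed.

End Identification.

Arguments identify n hn q : clear implicits.

Definition X_ (n : nat) (hn : (3 <= n)%N) : set int :=
  [set m : int | (0 <= m < (Nord (Kn n hn) : int))%R /\
                 coprimez (2 * m + 1)%R (Nord (Kn n hn) : int)].

Definition kappa (m : int) : int := if (2 %| m)%Z then (- m)%R else (m + 1)%R.

Arguments X_ n hn m : clear implicits.

Definition shadow_triple (n : nat) (m k : int) : int * D3 n :=
  (m, (zexp (rr n) (2 * k)%R, zexp (rr n) (- (2 * k))%R, zexp (rr n) (kappa m))).

(* Main.v *)
(** Write psi f = (r^a, r^b, r^c) and e = 2m + 1. Conjugation by sigma1 and sigma2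
    acts on psi(PB3) by explicit endomorphisms of D_n^3, so both hexagon relations
    become congruences modulo n, and each of them says a + b = 0 and c = kappa(m).
    The derived subgroup of G_n consists of the triples (r^2i, r^2j, r^2k) with
    i, j, k of the same parity; comparing with the hexagons gives the two cases,
    since the parity of i is determined by r^2i exactly when 4 divides n.

    On PB3, the map T_{m,f} corresponds under psi to an endomorphism of D_n^3 that
    raises rotations to powers prime to n, hence is injective; so ker T_{m,f} = K and,
    B3/K being finite, T_{m,f} is onto. Conversely, if ker T_{m,f} = K for a shadow
    with target N, then f lifts through T_{m,f} to a g whose psi-image consists of
    rotations, and the same comparison applied to the projection B3 -> B3/N, written
    through T_{m,f} with an odd inverse of e, gives K <= N, and then K = N by
    finiteness. *)

Require Import Defs.
From mathcomp Require Import all_boot all_order all_algebra perm.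
From mathcomp Require Import boolp classical_sets cardinality.
From mathcomp Require Import generic_quotient zify ring.

Set Implicit Arguments.
Unset Strict Implicit.
Unset Printing Implicit Defensive.

Import Order.TTheory GRing.Theory Num.Theory.

Local Open Scope classical_set_scope.
Local Open Scope quotient_scope.
Local Open Scope group_scope.

(** * Homomorphisms, integer powers and orders of elements *)

Section Morphisms.
Variables (G H : groupType) (f : G -> H).
Hypothesis fM : {morph f : x y / x * y}.

Lemma morph_one : f 1 = 1.
Proof. by apply: (@mulgI _ (f 1)); rewrite -fM !mulg1. Qed.

Lemma morph_inv x : f x^-1 = (f x)^-1.
Proof. by apply: (@mulgI _ (f x)); rewrite -fM !mulgV morph_one. Qed.

Lemma zexp_morph x (i : int) : f (zexp x i) = zexp (f x) i.
Proof.
have fX (k : nat) : f (x ^+ k) = f x ^+ k.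
  by elim: k => [|k IH]; [exact: morph_one|rewrite !expgS fM IH].
by case: i => k; rewrite /= ?morph_inv fX.
Qed.

Lemma morph_conj x y : f (x ^ y) = f x ^ f y.
Proof. by rewrite !conjgE !fM morph_inv. Qed.

Lemma morph_comm x y : f [~ x, y] = [~ f x, f y].
Proof. by rewrite !commgEl fM morph_inv morph_conj. Qed.

End Morphisms.

Section IntegerPowers.
Variable G : groupType.
Implicit Types (x y : G) (i j : int).

Lemma zexp_nat x (k : nat) : zexp x (k : int) = x ^+ k. Proof. by []. Qed.

Lemma zexpN x i : zexp x (- i)%R = (zexp x i)^-1.
Proof.
case: i => [[|k]|k]; [by rewrite oppr0 /= invg1| |].
  by rewrite -NegzE.
by rewrite NegzE opprK /= invgK.
Qed.

Lemma zexp_subn x (a b : nat) : zexp x ((a : int) - (b : int))%R = x ^+ a * x ^- b.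
Proof.
case: (leqP b a) => [ba|/ltnW ab].
  by rewrite subzn // zexp_nat expgnFr.
rewrite -opprB subzn // zexpN zexp_nat expgnFr // invgM invgK.
by [].
Qed.

Lemma zexpD x i j : zexp x (i + j)%R = zexp x i * zexp x j.
Proof.
(* Writing both exponents as differences of natural numbers replaces the analysis of signs by a
   single commutation of powers of [x]. *)
have H (k : int) : exists a b : nat, k = ((a : int) - (b : int))%R.
  case: k => k; [exists k, 0%N|exists 0%N, k.+1]; by rewrite ?subr0 // NegzE sub0r.
have [a [b ->]] := H i; have [c [d ->]] := H j.
have -> : ((a : int) - (b : int) + ((c : int) - (d : int)) =
   ((a + c)%N : int) - ((d + b)%N : int))%R by lia.
rewrite !zexp_subn !expgnDr invgM !mulgA; congr (_ * _).
rewrite -!mulgA; congr (_ * _).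
have /commute_sym/commuteV/commute_sym xx : commute (x ^+ c) (x ^+ b).
  by apply: commuteX2; exact: commute_refl.
have := @commuteX2 G x x c b (commute_refl x).
by move=> /commuteV ->.
Qed.

Lemma zexpM x i j : zexp x (i * j)%R = zexp (zexp x i) j.
Proof.
have P (k : nat) : zexp x (i * k%:Z)%R = zexp x i ^+ k.
  by elim: k => [|k IH]; rewrite ?mulr0 // -addn1 PoszD mulrDr mulr1 zexpD IH addn1 expgSr.
by case: j => k; rewrite ?NegzE ?mulrN ?zexpN P.
Qed.

Lemma zexp_add1 x i : zexp x (i + 1)%R = zexp x i * x.
Proof. exact: zexpD. Qed.
Lemma zexpJ x y i : zexp x i ^ y = zexp (x ^ y) i.
Proof. by apply: (@zexp_morph _ _ (fun z => z ^ y)) => u v; rewrite conjMg. Qed.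
Lemma zexp_inv x i : zexp x^-1 i = (zexp x i)^-1.
Proof. by rewrite -[x^-1](zexpN x 1%R) -zexpM mulN1r zexpN. Qed.
Lemma commute_zexp x y i : commute x y -> commute x (zexp y i).
Proof. by move=> xy; case: i => k; [|apply: commuteV]; apply: commuteX. Qed.
Lemma zexp1g i : zexp (1 : G) i = 1.
Proof. by case: i => k; rewrite /= expg1n ?invg1. Qed.
Lemma zexp_eq1_mod x (k : nat) i : x ^+ k = 1 -> (k %| i)%Z -> zexp x i = 1.
Proof. by move=> xk /dvdzP[q ->]; rewrite mulrC zexpM /= xk zexp1g. Qed.
Lemma zexp_involutive x i : x * x = 1 -> zexp x i = if (2 %| i)%Z then 1 else x.
Proof.
move=> xx; case: ifP => [|/negbT h]; first by apply: zexp_eq1_mod.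
have -> : i = (2 * (i %/ 2)%Z + 1)%R by lia.
by rewrite zexp_add1 (zexp_eq1_mod (k := 2)) ?mul1g // dvdz_mulr.
Qed.

Lemma order_eltP x (k : nat) : (order_elt x %| k)%N -> x ^+ k = 1.
Proof.
(* An infinite order is recorded as 0, and 0 divides only [k = 0]. *)
rewrite /order_elt; case: pselect => [e|_]; last by rewrite dvd0n => /eqP->.
by case: ex_minnP => m /andP[_ /eqP xm] _ /dvdnP[q ->]; rewrite mulnC expgnA xm expg1n.
Qed.

Lemma order_eltE x (k : nat) : (0 < k)%N ->
  (forall j : nat, x ^+ j = 1 <-> (k %| j)%N) -> order_elt x = k.
Proof.
move=> k0 H; rewrite /order_elt; case: pselect => [e|[]]; last first.
  by exists k; rewrite k0; apply/eqP/H.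
case: ex_minnP => m /andP[m0 /eqP/H km] /(_ k).
by rewrite k0 (proj2 (H k) (dvdnn k)) eqxx => /(_ isT) mk; apply/eqP; rewrite eqn_leq mk dvdn_leq.
Qed.

End IntegerPowers.

(** * Self-maps of finite sets *)

Lemma finite_inj_surj (T : Type) (f : T -> T) :
  finite_set [set: T] -> injective f -> range f = [set: T].
Proof.
move=> fin fi; apply/seteqP; split=> // y _; apply: contrapT => ny.
(* If [f] missed [y], the iterates of [y] would be pairwise distinct, and [nat] would embed in a
   finite set. *)
have ii i : injective (iter i f) by elim: i => [//|i IH] a b /= /fi/IH.
have neq i j : (i < j)%N -> iter i f y <> iter j f y.
  move=> ij; rewrite -(subnKC ij) addSnnS iterD => /ii E; apply: ny.
  by exists (iter (j - i.+1) f y).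
apply: infinite_nat; apply: (@finite_preimage _ _ [set: T] (fun i => iter i f y)) => //.
by move=> i j _ _ E; case: (ltngtP i j) => // /neq; rewrite E.
Qed.

Lemma finite_surj_inj (T : Type) (f : T -> T) :
  finite_set [set: T] -> range f = [set: T] -> injective f.
Proof.
move=> fin fs; have H y : exists x, f x = y.
  by have : [set: T] y by []; rewrite -fs => -[x _ <-]; exists x.
(* A section [g] of [f] is injective, hence onto by [finite_inj_surj], so every point has the form
   [g a], where [f] is inverted. *)
pose g y := sval (cid (H y)); have fg : cancel g f by move=> y; rewrite /g; case: cid.
have gs : range g = [set: T] by apply: finite_inj_surj => //; exact: can_inj fg.
move=> x y; have : range g x by rewrite gs.
have : range g y by rewrite gs.
by move=> [a _ <-] [b _ <-]; rewrite !fg => ->.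
Qed.

(** * Normal forms and endomorphisms of the dihedral group *)

Section DihedralElements.
Variable n : nat.
Local Notation r := (rr n).
Local Notation s := (ss n).
Implicit Types i j : int.

(** The exponent is an integer, relevant only modulo [n], so that computations with triples in D_n^3
    reduce to integer arithmetic with signs. *)
Definition dih (i : int) (b : bool) : D n := zexp r i * (if b then s else 1).

Lemma dih_false i : dih i false = zexp r i. Proof. exact: mulg1. Qed.
Lemma dih_rr : r = dih 1 false. Proof. by rewrite dih_false. Qed.
Lemma dih_ss : s = dih 0 true. Proof. by rewrite /dih mul1g. Qed.
Lemma dih1 : 1 = dih 0 false. Proof. by rewrite dih_false. Qed.

Lemma ss_zexp i : s * zexp r i = zexp r (- i)%R * s.
Proof.
have E : zexp r i ^ s = zexp r (- i)%R.
  by rewrite zexpJ conjgE ssV mulgA ssr -mulgA ssM mulg1 zexp_inv zexpN.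
by rewrite -E conjgE ssV mulgA -[RHS]mulgA ssM mulg1.
Qed.

Lemma dihM i j b c : dih i b * dih j c = dih (if b then i - j else i + j)%R (b (+) c).
Proof.
rewrite /dih; case: b; last by rewrite mulg1 mulgA zexpD.
rewrite -mulgA [s * _]mulgA ss_zexp zexpD !mulgA -[LHS]mulgA; congr (_ * _).
by case: c; rewrite ?ssM ?mulg1.
Qed.

Lemma dihV i b : (dih i b)^-1 = dih (if b then i else - i)%R b.
Proof.
apply: mulg1_eq; rewrite dihM addbb; case: b; rewrite ?subrr ?addrN //.
all: exact/esym/dih1.
Qed.

Lemma dih_zexp i k : zexp (dih i false) k = dih (i * k)%R false.
Proof. by rewrite !dih_false zexpM. Qed.

Lemma dih_zexp_true i k :
  zexp (dih i true) k = if (2 %| k)%Z then 1 else dih i true.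
Proof. by apply: zexp_involutive; rewrite dihM subrr; exact/esym/dih1. Qed.

Lemma dih_surj (x : D n) : exists i b, x = dih i b.
Proof.
elim/presented_ind: x => [|x g [i [b ->]]|x g [i [b ->]]].
- by exists 0%R, false; exact: dih1.
- case: g; rewrite -?/s -?/r ?dih_rr ?dih_ss dihM; by do 2 eexists.
- case: g; rewrite -?/s -?/r ?dih_rr ?dih_ss dihV dihM; by do 2 eexists.
Qed.

(** The relations only bound the order of [r] from above. The lower bound comes from an action on
    Z/n, with [r] as translation by 1 and [s] as negation: the [k]-th power of the translation moves
    0 to [k] modulo [n]. *)
Lemma rrX_eq1 (k : nat) : (1 < n)%N -> (r ^+ k = 1) <-> (n %| k)%N.
Proof.
move=> n1; split=> [|/dvdnP[q ->]]; last by rewrite mulnC expgnA rrX expg1n.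
pose a := perm (@addIr 'Z_n 1%R); pose b := perm (@oppr_inj 'Z_n).
have aX (x : 'Z_n) (m : nat) : (a ^+ m) x = (x + m%:R)%R.
  elim: m => [|m IH]; first by rewrite permE addr0.
  by rewrite expgSr permM IH permE -addrA -natr1.
have Zn : (n%:R = 0 :> 'Z_n)%R by rewrite pchar_Zp.
have an : a ^+ n = 1 by apply/permP => x; rewrite aX Zn addr0 permE.
have bb : b * b = 1 by apply/permP => x; rewrite permM !permE opprK.
have ba : b * a = a^-1 * b.
  apply/permP => x; rewrite permM !permE /=; apply: (@oppr_inj 'Z_n).
  rewrite [b (a^-1 x)]permE opprK; apply: (@perm_inj _ a); rewrite permKV.
  by rewrite permE opprD opprK addrNK.
have [f [fM fr _]] := dihedral_hom_exists an bb ba.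
move=> /(congr1 f); have := @zexp_morph _ _ f fM r; move=> /(_ (k : int)) /= ->.
rewrite (morph_one fM).
move=> /permP /(_ 0%R); rewrite fr aX permE add0r => /(congr1 val).
by rewrite /= val_Zp_nat // => /eqP.
Qed.

Lemma dih_eq1 i : (1 < n)%N -> (dih i false = 1) <-> (n %| i)%Z.
Proof.
move=> n1; rewrite dih_false; case: i => k; first exact: rrX_eq1.
rewrite /= -/(r ^- k.+1); split=> [E|/(rrX_eq1 _ n1) ->]; last exact: invg1.
by apply/(rrX_eq1 k.+1 n1); rewrite -[LHS]invgK E invg1.
Qed.

Lemma dih_eq i j b : (1 < n)%N -> (dih i b = dih j b) <-> (n %| (i - j)%R)%Z.
Proof.
move=> n1; rewrite -dih_eq1 //; split=> [E|E].
  suff : dih i b * (dih j b)^-1 = 1 by rewrite dihV dihM addbb; case: b E.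
  by rewrite E mulgV.
by rewrite -[i](subrK j) -[dih j b]mul1g -E dihM.
Qed.

(** Killing [r] and sending [s] to the transposition of two points is a homomorphism, and it detects
    reflections. *)
Lemma dih_true_neq1 i : dih i true <> 1.
Proof.
pose t : {perm bool} := tperm false true.
have t1 : t * 1 = 1^-1 * t by rewrite invg1 mul1g mulg1.
have [f [fM fr fs]] := dihedral_hom_exists (expg1n _ n) (tperm2 _ _ : t * t = 1) t1.
have f1 := morph_one fM.
move=> /(congr1 f); rewrite f1 fM (zexp_morph fM) fr zexp1g mul1g fs => /permP/(_ false).
by rewrite tpermL permE.
Qed.

(** This two-parameter family, [r] to r^e and [s] to r^t s, supplies the endomorphisms through which
    conjugations and T_{m,f} act on each factor of D_n^3. *)
Lemma dihedral_endo_dih (e t : int) : exists f : D n -> D n,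
  {morph f : x y / x * y} /\ forall i b, f (dih i b) = dih (if b then e * i + t else e * i)%R b.
Proof.
have [f [fM fr fs]] : exists f : D n -> D n,
    [/\ {morph f : x y / x * y}, f r = dih e false & f s = dih t true].
  apply: dihedral_endo; last by rewrite dihV !dihM addrC.
  - rewrite dih_false -zexp_nat -zexpM mulrC zexpM.
    by rewrite zexp_nat rrX zexp1g.
  - by rewrite dihM subrr; exact/esym/dih1.
exists f; split=> // i b; have f1 := morph_one fM.
rewrite /dih fM (zexp_morph fM) fr dih_false -zexpM; case: b; last by rewrite f1.
by rewrite fs /dih mulgA zexpD.
Qed.

End DihedralElements.

Arguments dih {n} i b.

(** * Values of [psi] on pure braids and their conjugates *)

Section PurePsi.
Variable n : nat.
Local Notation psi := (psi n).
Implicit Types (x y : B3) (i j k : int).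

Lemma PB3_1 : PB3 1. Proof. exact: (subgroup1 (Subgroup PB3_closed)). Qed.
Lemma PB3M x y : PB3 x -> PB3 y -> PB3 (x * y).
Proof. exact: (@subgroupM _ (Subgroup PB3_closed)). Qed.
Lemma PB3V x : PB3 x -> PB3 x^-1.
Proof. exact: (@subgroupV _ (Subgroup PB3_closed)). Qed.
Lemma PB3_zexp x i : PB3 x -> PB3 (zexp x i).
Proof.
move=> px; have pX (k : nat) : PB3 (x ^+ k).
  by elim: k => [|k IH]; [exact: PB3_1|rewrite expgS; exact: PB3M].
by case: i => k; [|apply: PB3V]; exact: pX.
Qed.

Lemma zexp_triple (d : D3 n) i : zexp d i = (zexp d.1.1 i, zexp d.1.2 i, zexp d.2 i).
Proof.
have M1 : {morph (fun e : D3 n => e.1.1) : x y / x * y} by [].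
have M2 : {morph (fun e : D3 n => e.1.2) : x y / x * y} by [].
have M3 : {morph (fun e : D3 n => e.2) : x y / x * y} by [].
rewrite -(zexp_morph M1) -(zexp_morph M2) -(zexp_morph M3).
by case: (zexp d i) => -[].
Qed.

Lemma psi_zexp x i : PB3 x -> psi (zexp x i) = zexp (psi x) i.
Proof.
move=> px; have pX (k : nat) : psi (x ^+ k) = psi x ^+ k.
  elim: k => [|k IH]; first exact: psi1.
  by rewrite !expgS psiM ?IH //; exact: (@PB3_zexp x k px).
case: i => k /=; first exact: pX.
by rewrite psiV ?pX //; exact: (@PB3_zexp x k.+1 px).
Qed.

Lemma psi_x12_dih : psi x12 = (dih 1 false, dih 0 true, dih 0 true).
Proof. by rewrite psi_x12 -dih_rr -dih_ss. Qed.
Lemma psi_x23_dih : psi x23 = (dih 1 true, dih 1 false, dih 1 true).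
Proof. by rewrite psi_x23 -dih_rr [dih 1 true]/dih /=. Qed.

Lemma psi_x12_zexp i : psi (zexp x12 i) = if (2 %| i)%Z
  then (dih i false, dih 0 false, dih 0 false) else (dih i false, dih 0 true, dih 0 true).
Proof.
rewrite psi_zexp; last exact: PB3_x12.
rewrite psi_x12_dih zexp_triple /= dih_zexp !dih_zexp_true mul1r.
by case: ifP; rewrite // -dih1.
Qed.

Lemma psi_x23_zexp i : psi (zexp x23 i) = if (2 %| i)%Z
  then (dih 0 false, dih i false, dih 0 false) else (dih 1 true, dih i false, dih 1 true).
Proof.
rewrite psi_zexp; last exact: PB3_x23.
rewrite psi_x23_dih zexp_triple /= dih_zexp !dih_zexp_true mul1r.
by case: ifP; rewrite // -dih1.
Qed.

Lemma psi_cc_zexp i : psi (zexp cc i) = 1.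
Proof. by rewrite psi_zexp ?psi_cc ?zexp1g //; exact: PB3_cc. Qed.

Lemma psi_dihM x y i j k i' j' k' a b c a' b' c' : PB3 x -> PB3 y ->
  psi x = (dih i a, dih j b, dih k c) -> psi y = (dih i' a', dih j' b', dih k' c') ->
  psi (x * y) = (dih (if a then i - i' else i + i')%R (a (+) a'),
                 dih (if b then j - j' else j + j')%R (b (+) b'),
                 dih (if c then k - k' else k + k')%R (c (+) c')).
Proof.
by move=> px py Ex Ey; rewrite psiM // Ex Ey -!dihM.
Qed.

Lemma psi_dihV x i j k a b c : PB3 x ->
  psi x = (dih i a, dih j b, dih k c) ->
  psi x^-1 = (dih (if a then i else - i)%R a, dih (if b then j else - j)%R b,
              dih (if c then k else - k)%R c).
Proof. by move=> px Ex; rewrite psiV // Ex -!dihV. Qed.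

Lemma psi_conj (g : B3) (e : D3 n -> D3 n) : commute g cc -> {morph e : d d' / d * d'} ->
  psi (x12 ^ g) = e (psi x12) -> psi (x23 ^ g) = e (psi x23) ->
  forall x, PB3 x -> psi (x ^ g) = e (psi x).
Proof.
move=> gc eM E1 E2; have e1 := morph_one eM.
apply: PB3_hom_eq => //.
- by move=> y z py pz; rewrite conjMg psiM //; apply: PB3_conj.
- by move=> y z py pz; rewrite psiM.
- by rewrite psi_cc e1 conjgE -gc mulKg psi_cc.
Qed.

(** Conjugation by [sigma1] exchanges the last two factors of D_n^3 up to endomorphisms of the
    factors; these are found from the conjugates of [x12] and [x23]. *)
Lemma psi_conj_sigma1 x i j k a b c : PB3 x ->
  psi x = (dih i a, dih j b, dih k c) ->
  psi (x ^ sigma1) = (dih (if a then i - 1 else i)%R a, dih k c, dih (- j)%R b).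
Proof.
move=> px Ex.
have [phi [phiM phiE]] := dihedral_endo_dih n 1 (-1).
have [iota [iotaM iotaE]] := dihedral_endo_dih n (-1) 0.
pose e (d : D3 n) : D3 n := (phi d.1.1, d.2, iota d.1.2).
rewrite (@psi_conj _ e) //.
- by rewrite Ex /e /= phiE iotaE mul1r mulN1r addr0; case: (b).
- exact: cc_sigma1.
- by move=> d d'; rewrite /e /= phiM iotaM.
- have -> : x12 ^ sigma1 = x12 by rewrite /x12 expg2 conjgE !mulgA mulVg mul1g.
  by rewrite psi_x12_dih /e /= phiE iotaE mulr0 addr0.
- rewrite x23_conj1 psi_v psi_x23_dih /e /= phiE iotaE /=.
  by rewrite dih_rr dih_ss dihV dihM.
Qed.

(** Here the outer two factors are exchanged. The endomorphism [kap] inverts [r] and sends [s] to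
    r^2 s, whence the exponent [2 - k] of a reflection. *)
Lemma psi_conj_sigma2 x i j k a b c : PB3 x ->
  psi x = (dih i a, dih j b, dih k c) ->
  psi (x ^ sigma2) = (dih (if c then 2 - k else - k)%R c,
                      dih (if b then j - 1 else j)%R b, dih i a).
Proof.
move=> px Ex.
have [phi [phiM phiE]] := dihedral_endo_dih n 1 (-1).
have [kap [kapM kapE]] := dihedral_endo_dih n (-1) 2.
pose e (d : D3 n) : D3 n := (kap d.2, phi d.1.2, d.1.1).
rewrite (@psi_conj _ e) //.
- by rewrite Ex /e /= phiE kapE mul1r mulN1r addrC.
- exact: cc_sigma2.
- by move=> d d'; rewrite /e /= phiM kapM.
- rewrite x12_conj2 psi_u psi_x12_dih /e /= phiE kapE /=.
  by rewrite dih_rr dih_ss dihV !dihM.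
- have -> : x23 ^ sigma2 = x23 by rewrite /x23 expg2 conjgE !mulgA mulVg mul1g.
  by rewrite psi_x23_dih /e /= phiE kapE.
Qed.

End PurePsi.

(** * Quotient maps, powers of the braid generators, and divisibility *)

Section QuotientPi.
Variables (G : groupType) (N : normal_subgroup G).
Local Notation pi := (\pi_(quotient N)).

Lemma pi_eq1 (x : G) : (pi x = 1) <-> N x.
Proof.
split=> [/esym/quotient_eq|Nx]; first by rewrite invg1 mul1g.
by apply/esym/quotient_eq; rewrite invg1 mul1g.
Qed.

Lemma pi_zexp (x : G) (i : int) : pi (zexp x i) = zexp (pi x) i.
Proof. exact: (zexp_morph (@quotient_piM G N)). Qed.

Lemma piX (x : G) (k : nat) : pi (x ^+ k) = pi x ^+ k.
Proof. exact: (pi_zexp x k). Qed.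

Lemma pi_surj (q : quotient N) : exists x, q = pi x.
Proof. by exists (repr q); rewrite reprK. Qed.

End QuotientPi.

Lemma zexp_sigma1 (m : int) : zexp sigma1 (2 * m + 1)%R = zexp x12 m * sigma1.
Proof. by rewrite zexp_add1 zexpM. Qed.
Lemma zexp_sigma2 (m : int) : zexp sigma2 (2 * m + 1)%R = zexp x23 m * sigma2.
Proof. by rewrite zexp_add1 zexpM. Qed.

Lemma commute_cc (g : B3) (i : int) : commute g (zexp cc i).
Proof.
apply: commute_zexp; elim/B3_ind: g => [|g IH|g IH|g IH|g IH].
- exact/commute_sym/commute1.
all: apply/commute_sym/commuteM; first exact/commute_sym.
- exact/commute_sym/cc_sigma1.
- exact/commute_sym/cc_sigma2.
- exact/commuteV/commute_sym/cc_sigma1.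
- exact/commuteV/commute_sym/cc_sigma2.
Qed.

Lemma dvdz_comb (p q d u v w : int) :
  (d %| u)%Z -> (d %| v)%Z -> w = (p * u + q * v)%R -> (d %| w)%Z.
Proof. by move=> du dv ->; rewrite rpredD // dvdz_mull. Qed.

(** The divisibilities to be derived are combinations of two known ones with coefficients 0, 1 or
    -1, found by trial. *)
Ltac dvdz_comb_tac hu hv :=
  let t p q := (apply: (@dvdz_comb p q _ _ _ _ hu hv); ring) in
  let p1 := constr:(1%R : int) in let p0 := constr:(0%R : int) in
  let m1 := constr:((-1)%R : int) in
  first [t p1 p0 | t p0 p1 | t p1 p1 | t p1 m1 | t m1 p0 | t p0 m1 | t m1 p1 | t m1 m1].

Ltac pure_tac := repeat match goal with
  | H : PB3 ?x |- PB3 ?x => exact H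
  | |- PB3 (_ * _) => apply: PB3M
  | |- PB3 (_ ^ _) => apply: PB3_conj
  end.

(** * The hexagon relations modulo K^(n) *)

Section HexagonsKn.
Variables (n : nat) (hn : (3 <= n)%N).
Local Notation K := (Kn n hn).
Local Notation psi := (psi n).

Let n1 : (1 < n)%N. Proof. exact: leq_trans hn. Qed.

(** Odd powers of the generators split into a pure braid and one generator, and the single
    generators are collected into conjugations. For pure [f] every factor on the right is pure, so
    [psi] can be evaluated there. *)
Lemma hexagon1_quotient (f : B3) (m : int) :
  (f^-1 * sigma1 * sigma2 * zexp x12 (- m)%R * zexp cc m)^-1 *
    (zexp sigma1 (2 * m + 1)%R * f^-1 * zexp sigma2 (2 * m + 1)%R * f) =
  zexp cc (- m)%R * zexp x12 m * ((f * zexp x12 m) ^ sigma1) ^ sigma2 *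
    (f^-1 * zexp x23 m) ^ sigma2 * f.
Proof.
rewrite -conjgM !conjgE zexp_sigma1 zexp_sigma2 !invgM !zexpN !invgK !mulgA.
by rewrite !mulgK.
Qed.

Lemma hexagon2_quotient (f : B3) (m : int) :
  (sigma2 * sigma1 * zexp x23 (- m)%R * zexp cc m * f)^-1 *
    (f^-1 * zexp sigma2 (2 * m + 1)%R * f * zexp sigma1 (2 * m + 1)%R) =
  f^-1 * zexp cc (- m)%R * zexp x23 m * ((f^-1 * zexp x23 m) ^ sigma2) ^ sigma1 *
    (f * zexp x12 m) ^ sigma1.
Proof.
rewrite -conjgM !conjgE zexp_sigma1 zexp_sigma2 !invgM !zexpN !invgK !mulgA.
by rewrite !mulgK.
Qed.

Lemma and_iff (A B C E : Prop) : (A <-> B) -> (C <-> E) -> (A /\ C) <-> (B /\ E).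
Proof. tauto. Qed.

Lemma hexagons_Kn (m : int) (f : F2) (a b c : int) :
  psi (val f) = (dih a false, dih b false, dih c false) ->
  hexagons K m f <-> (n %| (a + b)%R)%Z /\ (n %| (c - kappa m)%R)%Z.
Proof.
move=> Ef; have pf := F2_PB3 f; have pf' := PB3V pf.
have p12 := PB3_zexp m PB3_x12; have p23 := PB3_zexp m PB3_x23.
have pc := PB3_zexp (- m)%R PB3_cc.
have pJ (g x : B3) : PB3 x -> PB3 (x ^ g) by exact: PB3_conj.
have H (U V W : B3) : V^-1 * U = W -> PB3 W ->
    (\pi_(quotient K) U = \pi_(quotient K) V) <-> psi W = 1.
  by move=> <- pW; split=> [/esym/quotient_eq[]//|E]; apply/esym/quotient_eq; split.
have pfx := PB3M pf p12; have pfy := PB3M pf' p23.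
have H1 := H _ _ _ (hexagon1_quotient (val f) m)
  (PB3M (PB3M (PB3M (PB3M pc p12) (pJ _ _ (pJ _ _ pfx))) (pJ _ _ pfy)) pf).
have H2 := H _ _ _ (hexagon2_quotient (val f) m)
  (PB3M (PB3M (PB3M (PB3M pf' pc) p23) (pJ _ _ (pJ _ _ pfy))) (pJ _ _ pfx)).
have Ef' := psi_dihV pf Ef; have Ec : psi (zexp cc (- m)%R) = (dih 0 false, dih 0 false, dih 0 false).
  by rewrite psi_cc_zexp -dih1.
have Ex := psi_x12_zexp n m; have Ey := psi_x23_zexp n m.
have T1 (i j k : int) : ((dih i false, dih j false, dih k false) = 1 :> D3 n) <->
    [/\ (n %| i)%Z, (n %| j)%Z & (n %| k)%Z].
  split=> [[/(dih_eq1 _ n1) ? /(dih_eq1 _ n1) ? /(dih_eq1 _ n1) ?]|[]] //.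
  by move=> /(dih_eq1 _ n1)-> /(dih_eq1 _ n1)-> /(dih_eq1 _ n1)->.
have hexE : hexagons K m f <-> psi _ = 1 /\ psi _ = 1 := and_iff H1 H2.
have sx := psi_dihM pf p12 Ef; have sy := psi_dihM pf' p23 Ef'.
(* The parity of [m] decides whether [psi] of [x12] and [x23] to the power [m] contains reflections;
   this is also the case distinction in [kappa]. *)
rewrite hexE /kappa; case: ifP Ex Ey => m2 Ex Ey;
  move: (sx _ _ _ _ _ _ Ex) (sy _ _ _ _ _ _ Ey) => {}sx {}sy.
all: have c1 := psi_conj_sigma1 pfx sx; have c12 := psi_conj_sigma2 (pJ _ _ pfx) c1.
all: have c2 := psi_conj_sigma2 pfy sy; have c21 := psi_conj_sigma1 (pJ _ _ pfy) c2.
all: rewrite (psi_dihM _ pf (psi_dihM _ _ (psi_dihM _ _ (psi_dihM pc p12 Ec Ex) c12) c2) Ef);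
  [|pure_tac..].
all: rewrite (psi_dihM _ _ (psi_dihM _ _ (psi_dihM _ p23 (psi_dihM pf' pc Ef' Ec) Ey) c21) c1);
  [|pure_tac..].
(* The two congruences are read off from the first two coordinates of the first hexagon; conversely
   they give all six coordinates of both hexagons. *)
all: rewrite !T1 /=; split=> [[[h1 h2 h3] _]|[h1 h2]].
all: do ?split.
all: dvdz_comb_tac h1 h2.
Qed.

End HexagonsKn.

(** * The value of [Nord] at K^(n) and the derived subgroup of G_n *)

Section DerivedKn.
Variables (n : nat) (hn : (3 <= n)%N).
Local Notation K := (Kn n hn).
Local Notation psi := (psi n).
Local Notation pi := (\pi_(quotient (NF2 K))).
Implicit Types (i j k : int) (a b c : D n).

Lemma mulg_triple a b c a' b' c' :
  (a, b, c) * (a', b', c') = (a * a', b * b', c * c') :> D3 n.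
Proof. by []. Qed.
Lemma invg_triple a b c : (a, b, c)^-1 = (a^-1, b^-1, c^-1) :> D3 n.
Proof. by []. Qed.
Lemma conjg_triple a b c a' b' c' :
  (a, b, c) ^ (a', b', c') = (a ^ a', b ^ b', c ^ c') :> D3 n.
Proof. by []. Qed.
Lemma commg_triple a b c a' b' c' :
  [~ (a, b, c), (a', b', c')] = ([~ a, a'], [~ b, b'], [~ c, c']) :> D3 n.
Proof. by []. Qed.

Let n1 : (1 < n)%N. Proof. exact: leq_trans hn. Qed.

(** The images of [x12] and [x23] each have a rotation of order [n] and reflections of order 2 as
    coordinates, while [cc] lies in K^(n). *)
Lemma Nord_Kn : Nord K = lcmn n 2.
Proof.
have piK (x : B3) (j : nat) : PB3 x ->
    (\pi_(quotient K) x ^+ j = 1) <-> psi (zexp x j) = 1.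
  move=> px; rewrite -(piX K); split=> [/pi_eq1[]//|E]; apply/pi_eq1; split=> //.
  exact: (@PB3_zexp x j px).
have n0 : (0 < lcmn n 2)%N by rewrite lcmn_gt0 (ltnW n1).
have o12 : order_elt (\pi_(quotient K) x12) = lcmn n 2.
  apply: order_eltE => // j; rewrite piK; last exact: PB3_x12.
  rewrite psi_x12_zexp dvdn_lcm; case: ifP => j2.
    rewrite (_ : (2 %| j)%N) ?andbT; last exact: j2.
    by rewrite -!dih1; split=> [[/dih_eq1]|/(dih_eq1 j n1) ->] //; apply.
  by rewrite (_ : (2 %| j)%N = false) ?andbF //; split=> // -[_ /dih_true_neq1].
have o23 : order_elt (\pi_(quotient K) x23) = lcmn n 2.
  apply: order_eltE => // j; rewrite piK; last exact: PB3_x23.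
  rewrite psi_x23_zexp dvdn_lcm; case: ifP => j2.
    rewrite (_ : (2 %| j)%N) ?andbT; last exact: j2.
    by rewrite -!dih1; split=> [[/dih_eq1]|/(dih_eq1 j n1) ->] //; apply.
  by rewrite (_ : (2 %| j)%N = false) ?andbF //; split=> // -[/dih_true_neq1].
have occ : order_elt (\pi_(quotient K) cc) = 1%N.
  apply: order_eltE => // j; rewrite piK; last exact: PB3_cc.
  by rewrite psi_cc_zexp dvd1n.
rewrite /Nord o12 o23 occ lcmn1; apply/eqP.
by rewrite eqn_dvd dvdn_lcml dvdn_lcm dvdnn.
Qed.

Lemma psi_val_morph : {morph (fun f : F2 => psi (val f)) : f g / f * g}.
Proof. by move=> f g; rewrite valF2_M psiM //; exact: F2_PB3. Qed.

Lemma dih_comm i j (b c : bool) : [~ dih i b, dih j c] = dih (2 *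
  (if b then if c then i - j else j else if c then - i else 0))%R false :> D n.
Proof.
rewrite commgEl conjgE !dihV !dihM; case: b; case: c; congr (dih _ _) => /=; ring.
Qed.

(** The parity conditions bear on some choice of the halves [i], [j], [k]. Unless 4 divides [n], a
    half can change parity without changing its rotation, by adding [n] or [n/2], whichever is
    odd. *)
Definition even_rotations (d : D3 n) : Prop := exists i j k : int,
  [/\ d = (dih (2 * i)%R false, dih (2 * j)%R false, dih (2 * k)%R false),
      (2 %| (i - j)%R)%Z & (2 %| (i - k)%R)%Z].

(* p and q are the parities of the exponent sums in x12 and x23. *)
Definition parity_triple (d : D3 n) : Prop := exists i j k (p q : bool),
  [/\ d = (dih i q, dih j p, dih k (p (+) q)),
      (2 %| (i + (p + q)%N)%R)%Z, (2 %| (j + q)%R)%Z & (2 %| (k + q)%R)%Z].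

(** The congruences hold at both generators and survive products and inverses. They tie the
    exponents to the positions of the reflections, which is what fixes the parities of the halves in
    a commutator. *)
Lemma psi_F2_parity (f : F2) : parity_triple (psi (val f)).
Proof.
pose S := [set x : B3 | PB3 x /\ parity_triple (psi x)].
suff /(_ (val f)) : F2 `<=` S by move=> /(_ (set_mem (valP f)))[].
apply: smallest_sub; last first.
  move=> x [->|->]; split; [exact: PB3_x12| |exact: PB3_x23|].
    by exists 1%R, 0%R, 0%R, true, false; rewrite psi_x12_dih.
  by exists 1%R, 1%R, 1%R, false, true; rewrite psi_x23_dih.
apply: group_closedP.
- split; first exact: PB3_1.
  by rewrite psi1; exists 0%R, 0%R, 0%R, false, false; rewrite -!dih1.
- move=> x y [px [i [j [k [p [q [Ex i2 j2 k2]]]]]]] [py [i' [j' [k' [p' [q' [Ey i2' j2' k2']]]]]]].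
  split; first exact: PB3M.
  rewrite (psi_dihM px py Ex Ey); do 3 eexists; exists (p (+) p'), (q (+) q'); split.
  + by rewrite addbACA.
  + by clear -i2 i2'; case: p p' q q' i2 i2' => -[] [] [] /=; lia.
  + by clear -j2 j2'; case: p; case: q q' j2 j2' => -[] /=; lia.
  + by clear -k2 k2'; case: p; case: q q' k2 k2' => -[] /=; lia.
- move=> x [px [i [j [k [p [q [Ex i2 j2 k2]]]]]]]; split; first exact: PB3V.
  rewrite (psi_dihV px Ex); do 3 eexists; exists p, q; split; first by [].
  + by clear -i2; case: p q i2 => -[] /=; lia.
  + by clear -j2; case: p; case: q j2 => /=; lia.
  + by clear -k2; case: p q k2 => -[] /=; lia.
Qed.

Lemma parity_triple_comm d d' :
  parity_triple d -> parity_triple d' -> even_rotations [~ d, d'].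
Proof.
move=> [i [j [k [p [q [-> i2 j2 k2]]]]]] [i' [j' [k' [p' [q' [-> i2' j2' k2']]]]]].
rewrite commg_triple !dih_comm; do 3 eexists; split; first by [].
- by clear -i2 i2' j2 j2'; case: p p' q q' i2 i2' j2 j2' => -[] [] [] /=; lia.
- by clear -i2 i2' k2 k2'; case: p p' q q' i2 i2' k2 k2' => -[] [] [] /=; lia.
Qed.

Lemma derived_even_rotations (f : F2) :
  derived_subgroup (quotient (NF2 K)) (pi f) -> even_rotations (psi (val f)).
Proof.
(* Since [psi] factors through the quotient, the claim can be checked on commutators there. *)
pose Psi (q : quotient (NF2 K)) : D3 n := psi (val (repr q)).
have PsiE g : Psi (pi g) = psi (val g).
  by apply/psi_F2/quotient_eq; rewrite reprK.
have PsiM : {morph Psi : a b / a * b}.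
  move=> a b; have [g ->] := pi_surj a; have [h ->] := pi_surj b.
  by rewrite -quotient_piM !PsiE psi_val_morph.
rewrite -PsiE; move: (pi f).
pose S := [set q : quotient (NF2 K) | even_rotations (Psi q)].
change (derived_subgroup (quotient (NF2 K)) `<=` S).
apply: smallest_sub; last first.
  move=> c [a [b ->]]; rewrite /S /mkset (morph_comm PsiM).
  by apply: parity_triple_comm; exact: psi_F2_parity.
apply: group_closedP; rewrite /S /mkset.
- by rewrite (morph_one PsiM); exists 0%R, 0%R, 0%R; rewrite mulr0 -dih1.
- move=> a b [i [j [k [Ea h1 h2]]]] [i' [j' [k' [Eb h1' h2']]]].
  exists (i + i')%R, (j + j')%R, (k + k')%R; rewrite PsiM Ea Eb; split; [|lia..].
  by rewrite mulg_triple !dihM /= -!mulrDr.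
- move=> a [i [j [k [Ea h1 h2]]]].
  exists (- i)%R, (- j)%R, (- k)%R; rewrite (morph_inv PsiM) Ea; split; [|lia..].
  by rewrite invg_triple !dihV /= -!mulrN.
Qed.

Lemma even_rotations_derived (k h : int) : (2 %| (k - h)%R)%Z ->
  exists f : F2, derived_subgroup (quotient (NF2 K)) (pi f) /\
    psi (val f) = (dih (2 * k)%R false, dih (- (2 * k))%R false, dih (2 * h)%R false).
Proof.
move=> kh.
have FX : x12 \in subgroup_set F2.
  by apply/mem_set => A [_]; apply; left.
have FY : x23 \in subgroup_set F2.
  by apply/mem_set => A [_]; apply; right.
pose X : F2 := Sub x12 FX; pose Y : F2 := Sub x23 FY.
have EX : psi (val X) = _ := psi_x12_dih n.
have EY : psi (val Y) = _ := psi_x23_dih n.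
(* Conjugation changes the signs of the coordinates of [W]: its conjugates by [Y], [Y * X] and [X]
   have exponents (2, 2, 2), (2, -2, -2) and (-2, -2, 2). Taken to the powers [q], [k], [q] they add
   up to (2k, -2k, 4q - 2k), and 4q = 2k + 2h because [k + h] is even. *)
pose W : F2 := [~ X, Y]; pose q := ((k + h) %/ 2)%Z.
have M := psi_val_morph.
pose PV (f : F2) := psi (val f).
exists (zexp (W ^ Y) q * zexp (W ^ (Y * X)) k * zexp (W ^ X) q); split.
  set Q := derived_subgroup _.
  have QJ (g : F2) i : Q (pi (zexp (W ^ g) i)).
    rewrite pi_zexp.
    have : Q (pi (W ^ g)).
      apply: sub_gen_smallest; exists (pi (X ^ g)), (pi (Y ^ g)).
      by rewrite conjRg (morph_comm (@quotient_piM _ (NF2 K))).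
    move: (pi _) => w Qw; have QX (l : nat) : Q (w ^+ l).
      by elim: l => [|l IH]; [exact: subgroup1|rewrite expgS; exact: subgroupM].
    by case: i => l; [|apply: subgroupV]; exact: QX.
  by rewrite !quotient_piM; do 2?apply: subgroupM; exact: QJ.
have EW : PV W = (dih (-2) false, dih 2 false, dih (-2) false).
  by rewrite /PV (morph_comm M) EX EY commg_triple !dih_comm.
have EWX : PV (W ^ X) = (dih (-2) false, dih (-2) false, dih 2 false).
  by rewrite /PV (morph_conj M) EX -/(PV W) EW conjg_triple !conjgE !dihV !dihM.
have EWY : PV (W ^ Y) = (dih 2 false, dih 2 false, dih 2 false).
  by rewrite /PV (morph_conj M) EY -/(PV W) EW conjg_triple !conjgE !dihV !dihM.
have EWYX : PV (W ^ (Y * X)) = (dih 2 false, dih (-2) false, dih (-2) false).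
  rewrite /PV conjgM (morph_conj M) EX -/(PV (W ^ Y)) EWY.
  by rewrite conjg_triple !conjgE !dihV !dihM.
rewrite !M !(zexp_morph M) -!/(PV _) EWX EWY EWYX !zexp_triple /= !dih_zexp.
rewrite !mulg_triple !dihM /=.
by congr (dih _ _, dih _ _, dih _ _); rewrite /q; lia.
Qed.

End DerivedKn.

(** * The homomorphism T_{m,f} of a solution of the hexagons *)

Lemma x23_delta (m : int) : zexp x23 m * (sigma2 * sigma1 * sigma2) =
  sigma2 * sigma1 * sigma2 * zexp x12 m.
Proof.
have E : x23 * (sigma2 * sigma1 * sigma2) = sigma2 * sigma1 * sigma2 * x12.
  by rewrite -braidE mulgA delta_sigma1 /x12 expg2 !mulgA.
have EJ : x23 ^ (sigma2 * sigma1 * sigma2) = x12 by rewrite conjgE E mulKg.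
by rewrite -EJ -zexpJ conjgE mulVKg.
Qed.

Section ShadowHom.
Variables (N : NFI) (m : int) (f : F2).
Hypothesis hex : hexagons N m f.
Local Notation pi := (\pi_(quotient N)).
Local Notation T := (Tmf N m f).
Local Notation e := (2 * m + 1)%R.
Let A := pi (zexp sigma1 e).
Let B := pi ((val f)^-1 * zexp sigma2 e * val f).

Let ABE : A * B = pi ((val f)^-1 * sigma1 * sigma2 * zexp x12 (- m)%R * zexp cc m).
Proof. by rewrite -(proj1 hex) -quotient_piM !mulgA. Qed.

Let BAE : B * A = pi (sigma2 * sigma1 * zexp x23 (- m)%R * zexp cc m * val f).
Proof. by rewrite -(proj2 hex) -quotient_piM. Qed.

Let ABA : A * B * A = pi ((val f)^-1 * (sigma2 * sigma1 * sigma2) * zexp cc m).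
Proof.
rewrite ABE -quotient_piM zexp_sigma1 zexpN -braidE; congr (pi _).
set X := zexp x12 m; set C := zexp cc m.
rewrite !mulgA -(mulgA _ C X) -(commute_cc X m) !mulgA mulgVK.
by rewrite -(mulgA _ C sigma1) -(commute_cc sigma1 m) mulgA.
Qed.

Let BAB1 : B * (A * B) = pi ((val f)^-1 * (sigma2 * sigma1 * sigma2) * zexp cc m).
Proof.
rewrite ABE -quotient_piM zexp_sigma2; congr (pi _).
rewrite -[in RHS](mulgK (zexp x12 m) (sigma2 * sigma1 * sigma2)) -x23_delta zexpN.
by rewrite !mulgA mulgK.
Qed.

Let BAB2 : B * A * B = pi (sigma2 * sigma1 * sigma2 * zexp cc m * val f).
Proof.
rewrite BAE -quotient_piM zexp_sigma2; congr (pi _).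
rewrite zexpN !mulgA mulgK; congr (_ * _).
set Y := zexp x23 m; set C := zexp cc m.
rewrite -(mulgA _ C Y) -(commute_cc Y m) !mulgA mulgVK.
by rewrite -(mulgA _ C sigma2) -(commute_cc sigma2 m) mulgA.
Qed.

(** Substituting the first hexagon for [A * B] turns both sides into f^-1 d c^m, with d the half
    twist: on the left the powers of [x12] cancel, on the right d carries the power of [x23] to one
    of [x12]. *)
Lemma Tmf_braid : A * B * A = B * A * B.
Proof. by rewrite -[RHS]mulgA BAB1 ABA. Qed.

Lemma TmfM : {morph T : x y / x * y}.
Proof. exact: braid_homM Tmf_braid. Qed.

Lemma Tmf_sigma1 : T sigma1 = A.
Proof. exact: braid_hom_sigma1 Tmf_braid. Qed.
Lemma Tmf_sigma2 : T sigma2 = B.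
Proof. exact: braid_hom_sigma2 Tmf_braid. Qed.

Lemma Tmf_x12 : T x12 = pi (zexp x12 e).
Proof.
rewrite -[x12 in LHS]/(sigma1 * sigma1) TmfM Tmf_sigma1 -quotient_piM -zexpD.
by rewrite -[x12]/(zexp sigma1 2) -zexpM; congr (pi (zexp _ _)); ring.
Qed.

Lemma Tmf_x23 : T x23 = pi (zexp x23 e ^ val f).
Proof.
rewrite -[x23 in LHS]/(sigma2 * sigma2) TmfM Tmf_sigma2 -quotient_piM conjgE !mulgA mulgK.
rewrite -[x23]/(zexp sigma2 2) -zexpM.
rewrite -[_ * zexp sigma2 e * zexp sigma2 e]mulgA -zexpD.
by congr (pi (_ * zexp _ _ * _)); ring.
Qed.

(* The half twist has the two images f^-1 d c^m and d c^m f, one from each hexagon,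
   and their product is central. *)
Lemma Tmf_cc : T cc = pi (zexp cc e).
Proof.
rewrite /cc expg2 !TmfM Tmf_sigma1 Tmf_sigma2 {2}Tmf_braid ABA BAB2 -quotient_piM.
congr (pi _); rewrite mulrC zexp_add1 zexpM /= expg2.
set d := sigma2 * sigma1 * sigma2; set C := zexp cc m.
have dd : d * d = cc by rewrite /cc braidE.
have z : commute (val f) (C * C * cc).
  by apply: commuteM; [apply: commuteM; exact: commute_cc|exact: (commute_cc _ 1%R)].
have dC x : x * d * C = x * C * d by rewrite -mulgA (commute_cc d m) mulgA.
rewrite braidE -/d dd -[RHS](mulKg (val f)) z -dd.
by clearbody d C; rewrite !mulgA !dC.
Qed.

End ShadowHom.

Lemma pi_braid_perm (N : NFI) (x y : B3) :
  \pi_(quotient N) x = \pi_(quotient N) y -> braid_perm x = braid_perm y.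
Proof.
move=> /quotient_eq/(@NFI_pure N); rewrite /PB3 /mkset braid_permM braid_permV => E.
by rewrite -[LHS]mulg1 -E mulVKg.
Qed.

(** T_{m,f} induces the identity on S_3, since odd powers and conjugation by the pure braid [f]
    leave the permutations of the generators unchanged. *)
Lemma Tmf_lift (N : NFI) (m : int) (f : F2) : hexagons N m f -> forall x,
  exists y, Tmf N m f x = \pi_(quotient N) y /\ braid_perm y = braid_perm x.
Proof.
move=> hex; have M := TmfM hex; have p1 := morph_one braid_permM.
have pf : braid_perm (val f) = 1 := F2_PB3 f.
have s1 : braid_perm (zexp sigma1 (2 * m + 1)%R) = braid_perm sigma1.
  by rewrite zexp_sigma1 braid_permM (PB3_zexp m PB3_x12) mul1g.
have s2 : braid_perm ((val f)^-1 * zexp sigma2 (2 * m + 1)%R * val f) = braid_perm sigma2.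
  by rewrite zexp_sigma2 !braid_permM braid_permV pf (PB3_zexp m PB3_x23) invg1 mulg1 !mul1g.
move: (Tmf_sigma1 hex) (Tmf_sigma2 hex) s1 s2.
set u := zexp sigma1 _; set v := _ * val f; clearbody u v => T1 T2 s1 s2.
elim/B3_ind => [|x [y [E p]]|x [y [E p]]|x [y [E p]]|x [y [E p]]].
- by exists 1; rewrite (morph_one M).
- by exists (y * u); rewrite M E T1 -quotient_piM !braid_permM s1 p.
- by exists (y * v); rewrite M E T2 -quotient_piM !braid_permM s2 p.
- exists (y * u^-1); rewrite M E (morph_inv M) T1 -quotient_piV -quotient_piM.
  by rewrite !braid_permM !braid_permV s1 p.
- exists (y * v^-1); rewrite M E (morph_inv M) T2 -quotient_piV -quotient_piM.
  by rewrite !braid_permM !braid_permV s2 p.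
Qed.

Lemma Tmf_braid_perm (N : NFI) (m : int) (f : F2) (x y : B3) : hexagons N m f ->
  Tmf N m f x = \pi_(quotient N) y -> braid_perm x = braid_perm y.
Proof.
by move=> hex E; have [z [Ez <-]] := Tmf_lift hex x; apply: (@pi_braid_perm N); rewrite -Ez.
Qed.

(** The related pure braids form a subgroup, so three generators suffice. The lemma compares T_{m,f}
    with the projection: with [theta] as T_{m,f} it yields the kernel for target K^(n), and with the
    roles exchanged it yields the inclusion of K^(n) in another target. *)
Lemma psi_transfer (n : nat) (H : groupType) (theta phi : B3 -> H) (alpha : D3 n -> D3 n) :
  {morph theta : x y / x * y} -> {morph phi : x y / x * y} ->
  {morph alpha : x y / x * y} ->
  let related x := exists y, [/\ PB3 y, theta x = phi y & psi n y = alpha (psi n x)] in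
  related x12 -> related x23 -> related cc -> forall x, PB3 x -> related x.
Proof.
move=> tM pM aM related r1 r2 r3.
suff sub : PB3 `<=` [set x | PB3 x /\ related x] by move=> x /sub[].
move=> x /PB3_generated; apply: smallest_sub; last first.
  by move=> z [[->|->]|->]; split=> //; [exact: PB3_x12|exact: PB3_x23|exact: PB3_cc].
apply: group_closedP.
- split; first exact: PB3_1.
  by exists 1; rewrite !psi1 (morph_one tM) (morph_one pM) (morph_one aM); split=> //; exact: PB3_1.
- move=> u v [pu [u' [pu' E1 E2]]] [pv [v' [pv' F1 F2]]]; split; first exact: PB3M.
  by exists (u' * v'); rewrite tM pM E1 F1 !psiM // aM E2 F2; split=> //; exact: PB3M.
- move=> u [pu [u' [pu' E1 E2]]]; split; first exact: PB3V.
  exists u'^-1; rewrite (morph_inv tM) (morph_inv pM) E1 !psiV // (morph_inv aM) E2.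
  by split=> //; exact: PB3V.
Qed.

(** The kernel condition makes the self-map induced by [T] on the finite group B3/N injective. *)
Lemma finite_quotient_surj (N : NFI) (T : B3 -> quotient N) :
  {morph T : x y / x * y} -> [set x | T x = 1] = subgroup_set N -> range T = setT.
Proof.
move=> TM kerT; pose S (q : quotient N) := T (repr q).
have inj : injective S.
  move=> a b E; rewrite -[a]reprK -[b]reprK; apply/quotient_eq.
  rewrite /in_subgroup -kerT /mkset TM (morph_inv TM).
  by apply: (@mulgI _ (T (repr a))); rewrite mulVKg mulg1.
have := finite_inj_surj (NFI_finite_index N) inj => sS.
apply/seteqP; split=> // q _; have : range S q by rewrite sS.
by move=> [a _ <-]; exists (repr a).
Qed.

(** * The kernel of T_{m,f} for the target K^(n) *)

Section ShadowsKn.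
Variables (n : nat) (hn : (3 <= n)%N).
Local Notation K := (Kn n hn).
Local Notation psi := (psi n).

Let n1 : (1 < n)%N. Proof. exact: leq_trans hn. Qed.

Lemma psi_generators_endo (e a c : int) : exists alpha : D3 n -> D3 n,
  [/\ {morph alpha : x y / x * y},
      alpha (psi x12) = (dih e false, dih 0 true, dih 0 true),
      alpha (psi x23) = (dih a true, dih e false, dih c true) &
      coprimez e n -> coprimez c n -> forall d, alpha d = 1 -> d = 1].
Proof.
(* The first coordinate of [psi x23] is r s, so the shift [a - e] makes its image r^a s. *)
have [f1 [M1 E1]] := dihedral_endo_dih n e (a - e)%R.
have [f2 [M2 E2]] := dihedral_endo_dih n e 0.
have [f3 [M3 E3]] := dihedral_endo_dih n c 0.
exists (fun d => (f1 d.1.1, f2 d.1.2, f3 d.2)); split.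
- by move=> d d'; rewrite /= M1 M2 M3.
- by rewrite psi_x12_dih /= E1 E2 E3 mulr1 !mulr0 !addr0.
- by rewrite psi_x23_dih /= E1 E2 E3 !mulr1 !addr0 addrC subrK.
- move=> ce cc [[x y] z] /= [].
  (* Reflections go to reflections, and on rotations the exponent is multiplied by a unit modulo
     [n]. *)
  have inj (g t : int) (w : D n) (h : D n -> D n) : coprimez g n ->
      (forall i b, h (dih i b) = dih (if b then g * i + t else g * i)%R b) -> h w = 1 -> w = 1.
    have [i [b ->]] := dih_surj w; move=> cg hE; rewrite hE; case: b => [/dih_true_neq1//|].
    by move=> /(dih_eq1 _ n1) h1; apply/(dih_eq1 _ n1); rewrite Gauss_dvdzr // coprimez_sym in h1.
  by move=> /(inj _ _ _ _ ce E1)-> /(inj _ _ _ _ ce E2)-> /(inj _ _ _ _ cc E3)->.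
Qed.

Lemma coprimez_Nord_Kn (e : int) : coprimez e (Nord K : int) -> coprimez e n.
Proof.
move=> h; apply: coprimez_dvdr h; rewrite Nord_Kn; exact: dvdn_lcml.
Qed.

(** The integer 1 - 2c is the factor by which T_{m,f} multiplies rotation exponents in the third
    coordinate; for c = kappa(m) it equals 2m + 1 or -(2m + 1). *)
Lemma coprimez_kappa (m c : int) : coprimez (2 * m + 1)%R n ->
  (n %| (c - kappa m)%R)%Z -> coprimez (- c + (1 - c))%R n.
Proof.
move=> cop /dvdzP[q E]; have {E} -> : c = (kappa m + q * n)%R by rewrite -E addrC subrK.
rewrite /kappa; case: ifP => _.
  have -> : (- (- m + q * n) + (1 - (- m + q * n)) = (- 2 * q) * n + (2 * m + 1))%R by ring.
  by rewrite coprimez_sym /coprimez gcdzMDl -/(coprimez _ _) coprimez_sym.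
have -> : (- (m + 1 + q * n) + (1 - (m + 1 + q * n)) = (- 2 * q) * n + - (2 * m + 1))%R by ring.
by rewrite coprimez_sym /coprimez gcdzMDl gcdzN -/(coprimez _ _) coprimez_sym.
Qed.

Lemma Tmf_ker_Kn (m : int) (f : F2) (a b c : int) :
  psi (val f) = (dih a false, dih b false, dih c false) ->
  hexagons K m f -> coprimez (2 * m + 1)%R (Nord K : int) ->
  [set x | Tmf K m f x = 1] = subgroup_set K.
Proof.
move=> Ef hex /coprimez_Nord_Kn cop; have pf := F2_PB3 f.
have cop' := coprimez_kappa cop (proj2 (proj1 (hexagons_Kn hn m Ef) hex)).
set e := (2 * m + 1)%R in cop *.
(* As [e] is odd, the reflections in [psi x12] and [psi x23] survive in their powers of exponent
   [e]. *)
have e2 : (2 %| e)%Z = false by rewrite /e; lia.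
(* Conjugating r s by r^a gives r^(-a + (1 - a)) s, and similarly with [c] in the third
   coordinate. *)
have [alpha [aM a1 a2 /(_ cop cop') ainj]] := psi_generators_endo e (- a + (1 - a))%R (- c + (1 - c))%R.
have p12 := PB3_zexp e PB3_x12; have p23 := PB3_zexp e PB3_x23.
have Ex := psi_x12_zexp n e; have Ey := psi_x23_zexp n e; rewrite e2 in Ex Ey.
have Eyf := psi_dihM (PB3V pf) (PB3M p23 pf) (psi_dihV pf Ef) (psi_dihM p23 pf Ey Ef).
have tr := psi_transfer (TmfM hex) (@quotient_piM _ K) aM _ _ _.
have {}tr : forall x, PB3 x ->
    exists y, [/\ PB3 y, Tmf K m f x = \pi_(quotient K) y & psi y = alpha (psi x)].
  apply: tr.
  - by exists (zexp x12 e); rewrite Tmf_x12 // a1.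
  - exists (zexp x23 e ^ val f); rewrite Tmf_x23 // a2; split=> //; first exact: PB3_conj.
    by rewrite conjgE Eyf /= [(- b + _)%R]addrC addrK.
  - by exists (zexp cc e); rewrite Tmf_cc // psi_cc_zexp psi_cc (morph_one aM); split=> //;
      exact: PB3_zexp PB3_cc.
apply/seteqP; split=> x.
  (* T_{m,f} preserves permutations, so its kernel consists of pure braids. *)
  move=> Tx; have px : PB3 x.
    rewrite /PB3 /mkset (Tmf_braid_perm (y := 1) hex) ?quotient_pi1 //.
    exact: morph_one braid_permM.
  have [y [py Ty Ay]] := tr x px; split=> //; apply: ainj; rewrite -Ay.
  have /esym : Tmf K m f x = 1 := Tx; rewrite Ty => /esym/pi_eq1[].
  by [].
move=> [px Ex1]; have [y [py Ty Ay]] := tr x px; rewrite /mkset Ty; apply/pi_eq1; split=> //.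
by rewrite Ay Ex1 (morph_one aM).
Qed.

End ShadowsKn.

(** * Morphisms with source K^(n) *)

Lemma NFI_eq (A B : NFI) : subgroup_set A = subgroup_set B -> A = B.
Proof.
case: A B => [[[SA cA] nA] pA fA] [[[SB cB] nB] pB fB] /= E.
subst SB; rewrite (Prop_irrelevance cB cA) in nB pB fB *.
rewrite (Prop_irrelevance nB nA) in pB fB *.
by rewrite (Prop_irrelevance pB pA) (Prop_irrelevance fB fA).
Qed.

(* B3/K and B3/N have the same finite order, as B3/K is isomorphic to B3/N by T. *)
Lemma NFI_ker_sub (K N : NFI) (T : B3 -> quotient N) :
  {morph T : x y / x * y} -> range T = setT -> [set x | T x = 1] = subgroup_set K ->
  subgroup_set K `<=` subgroup_set N -> K = N.
Proof.
move=> TM sT kerT KN; have lift q : exists u, T u = q.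
  by have : [set: quotient N] q by []; rewrite -sT => -[u _ <-]; exists u.
pose h q := sval (cid (lift q)); have hT q : T (h q) = q by rewrite /h; case: cid.
have reprN x : \pi_(quotient N) (repr (\pi_(quotient K) x)) = \pi_(quotient N) x.
  by apply/esym/quotient_eq/KN; exact: quotient_repr.
(* [S] is the projection from B3/K to B3/N followed by the inverse of the isomorphism induced by
   [T]. Being onto a finite set, it is injective, which puts [N] inside [K]. *)
pose S (a : quotient K) := \pi_(quotient K) (h (\pi_(quotient N) (repr a))).
have /finite_surj_inj inj : range S = setT.
  apply/seteqP; split=> // b _; have [u ->] := pi_surj b.
  have [x E] := pi_surj (T u); exists (\pi_(quotient K) x) => //.
  rewrite /S reprN -E; apply/quotient_eq.
  by rewrite /in_subgroup -kerT /mkset TM (morph_inv TM) hT mulVg.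
apply/NFI_eq/seteqP; split=> // x Nx; apply/pi_eq1.
rewrite -quotient_pi1; apply: inj; first exact: NFI_finite_index.
rewrite /S !reprN; congr (\pi_(quotient K) (h _)).
by rewrite quotient_pi1; apply/pi_eq1.
Qed.

Section IsolatedKn.
Variables (n : nat) (hn : (3 <= n)%N).
Local Notation K := (Kn n hn).
Local Notation psi := (psi n).

Lemma psi_comm x y : PB3 x -> PB3 y -> psi [~ x, y] = [~ psi x, psi y].
Proof.
move=> px py; have [px' py'] := (PB3V px, PB3V py).
by rewrite !commgEl !conjgE !psiM ?psiV //; do ?apply: PB3M.
Qed.

Definition rotations (d : D3 n) : Prop :=
  exists i j k, d = (dih i false, dih j false, dih k false).

Lemma rotations_comm (d d' : D3 n) : rotations [~ d, d'].
Proof.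
case: d d' => [[a b] c] [[a' b'] c']; rewrite commg_triple.
have [i [p ->]] := dih_surj a; have [i' [p' ->]] := dih_surj a'.
have [j [q ->]] := dih_surj b; have [j' [q' ->]] := dih_surj b'.
have [k [r ->]] := dih_surj c; have [k' [r' ->]] := dih_surj c'.
by rewrite !dih_comm; do 3 eexists.
Qed.

(** Modulo [N], [f] is a product of commutators and their inverses. Their entries lift through
    T_{m,f} to pure braids, and the commutators of these lifts have rotations as [psi]-values. *)
Lemma derived_lift_rotations (N : NFI) (m : int) (f : F2) : is_GT_shadow N m f ->
  exists g, [/\ PB3 g, Tmf N m f g = \pi_(quotient N) (val f) & rotations (psi g)].
Proof.
move=> [hex _ der sT]; have TM := TmfM hex.
pose Pi (q : quotient (NF2 N)) : quotient N := \pi_(quotient N) (val (repr q)).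
have PiE h : Pi (\pi_(quotient (NF2 N)) h) = \pi_(quotient N) (val h).
  apply/esym/quotient_eq; rewrite -valF2_V -valF2_M.
  exact: (@quotient_repr _ (NF2 N) h).
have PiM : {morph Pi : a b / a * b}.
  move=> a b; have [g ->] := pi_surj a; have [h ->] := pi_surj b.
  by rewrite -quotient_piM !PiE valF2_M quotient_piM.
have lift q : exists u, PB3 u /\ Tmf N m f u = Pi q.
  have : [set: quotient N] (Pi q) by [].
  rewrite -sT => -[u _ E]; exists u; split=> //.
  by rewrite /PB3 /mkset (Tmf_braid_perm hex E); exact: F2_PB3.
pose S := [set q | exists g, [/\ PB3 g, Tmf N m f g = Pi q & rotations (psi g)]].
suff /(_ _ der) : derived_subgroup (quotient (NF2 N)) `<=` S by rewrite /S /mkset PiE.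
apply: smallest_sub; last first.
  move=> c [a [b ->]]; have [u [pu Eu]] := lift a; have [v [pv Ev]] := lift b.
  exists [~ u, v]; split.
  - by rewrite commgEl; apply: PB3M; [exact: PB3V|exact: PB3_conj].
  - by rewrite (morph_comm TM) Eu Ev (morph_comm PiM).
  - by rewrite psi_comm //; exact: rotations_comm.
apply: group_closedP.
- exists 1; rewrite (morph_one TM) (morph_one PiM); split=> //; first exact: PB3_1.
  by rewrite psi1; exists 0%R, 0%R, 0%R; rewrite -dih1.
- move=> a b [u [pu Eu [i [j [k E]]]]] [v [pv Ev [i' [j' [k' E']]]]].
  exists (u * v); rewrite TM PiM Eu Ev; split=> //; first exact: PB3M.
  by rewrite (psi_dihM pu pv E E'); do 3 eexists.
- move=> a [u [pu Eu [i [j [k E]]]]].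
  exists u^-1; rewrite (morph_inv TM) (morph_inv PiM) Eu; split=> //; first exact: PB3V.
  by rewrite (psi_dihV pu E); do 3 eexists.
Qed.

Lemma pi_zexp_Nord (N : NFI) (x : B3) (i : int) : x = x12 \/ x = x23 \/ x = cc ->
  (Nord N %| (i - 1)%R)%Z -> \pi_(quotient N) (zexp x i) = \pi_(quotient N) x.
Proof.
move=> hx dvd; rewrite -[i](subrK 1%R) zexp_add1 quotient_piM pi_zexp.
rewrite (zexp_eq1_mod (k := Nord N)) ?mul1g //; apply: order_eltP.
case: hx => [->|[->|->]]; rewrite /Nord; first exact: dvdn_lcml.
  by apply: dvdn_trans (dvdn_lcmr _ _); exact: dvdn_lcml.
by apply: dvdn_trans (dvdn_lcmr _ _); exact: dvdn_lcmr.
Qed.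

Lemma GTSh_hom_from_Kn (N : NFI) : GTSh_hom K N !=set0 -> K = N.
Proof.
move=> [_ [m [f [_ sh kerT]]]]; have [hex cop _ sT] := sh.
have TM := TmfM hex; apply: (NFI_ker_sub TM sT kerT).
have [g [pg Tg [a [b [c Eg]]]]] := derived_lift_rotations sh.
set e := (2 * m + 1)%R in cop.
(* [Nord N] may be odd, so [e] is inverted modulo [2 * Nord N]; the inverse [j] is then odd and
   keeps the reflections. *)
have /coprimezP[[j v] /= jv] : coprimez e (2 * (Nord N : int))%R.
  by rewrite coprimezMr cop andbT /e; apply/coprimezP; exists (1%R, (- m)%R) => /=; ring.
have j2 : (2 %| j)%Z = false.
  apply/negP => j2; have : (2 %| (j * e + v * (2 * (Nord N : int)))%R)%Z.
    by rewrite rpredD // ?[(2 %| (j * _)%R)%Z]dvdz_mulr // dvdz_mull // dvdz_mulr.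
  by rewrite jv.
have ej : (Nord N %| (e * j - 1)%R)%Z.
  by apply/dvdzP; exists (- (2 * v))%R; rewrite -[X in (_ - X)%R]jv; ring.
have pj x : PB3 x -> PB3 (zexp x j) by exact: PB3_zexp.
have p23 := pj _ PB3_x23.
have Ey := psi_x23_zexp n j; rewrite j2 in Ey.
have Eyg := psi_dihM pg (PB3M p23 (PB3V pg)) Eg (psi_dihM p23 (PB3V pg) Ey (psi_dihV pg Eg)).
(* These exponents come from conjugating r s by the inverses of r^a and r^c. *)
have [alpha [aM a1 a2 _]] := psi_generators_endo hn j (a + (1 - - a))%R (c + (1 - - c))%R.
have tr := psi_transfer (@quotient_piM _ N) TM aM _ _ _.
have {}tr : forall x, PB3 x ->
    exists y, [/\ PB3 y, \pi_(quotient N) x = Tmf N m f y & psi y = alpha (psi x)].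
  apply: tr.
  - exists (zexp x12 j); rewrite (zexp_morph TM) Tmf_x12 // -pi_zexp -zexpM.
    rewrite pi_zexp_Nord //; last by left.
    by rewrite psi_x12_zexp j2 a1; split=> //; apply: pj; exact: PB3_x12.
  (* T_{m,f} sends [x23] to the conjugate by [f] of its power [e]: conjugation by the inverse of [g]
     removes [f], and the power [j] removes [e] modulo [Nord N]. *)
  - exists (zexp x23 j ^ g^-1); rewrite (morph_conj TM) (zexp_morph TM) Tmf_x23 //.
    rewrite (morph_inv TM) Tg -pi_zexp -quotient_piV -(morph_conj (@quotient_piM _ N)).
    rewrite -zexpJ conjgK -zexpM pi_zexp_Nord //; last by right; left.
    split=> //; first exact: PB3_conj.
    by rewrite conjgE invgK Eyg a2 /= (addrCA b) subrr addr0.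
  - exists (zexp cc j); rewrite (zexp_morph TM) Tmf_cc // -pi_zexp -zexpM.
    rewrite pi_zexp_Nord //; last by right; right.
    by rewrite psi_cc_zexp psi_cc (morph_one aM); split=> //; apply: pj; exact: PB3_cc.
move=> x [px Ex]; have [y [py Ty Ay]] := tr x px.
apply/pi_eq1; rewrite Ty; have : subgroup_set K y by split=> //; rewrite Ay Ex (morph_one aM).
by rewrite -kerT.
Qed.

End IsolatedKn.

(** * Isolation and the set of shadows with target K^(n) *)

Lemma half_kappa (m i k : int) : (2 %| (i - k)%R)%Z -> (4 %| (2 * k - kappa m)%R)%Z ->
  (i = (kappa m %/ 2)%Z %[mod 2])%Z.
Proof. by rewrite /kappa; case: ifP; lia. Qed.

Section GTKn.
Variables (n : nat) (hn : (3 <= n)%N).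
Local Notation K := (Kn n hn).
Local Notation psi := (psi n).

Let n1 : (1 < n)%N. Proof. exact: leq_trans hn. Qed.

Lemma GT_Kn_ker (m : int) (f : F2) : is_GT_shadow K m f ->
  [set x | Tmf K m f x = 1] = subgroup_set K.
Proof.
move=> [hex cop /derived_even_rotations [i [j [k [E _ _]]]] _].
exact: Tmf_ker_Kn E hex cop.
Qed.

Lemma isolated_Kn : isolated K.
Proof.
(* This equivalence passes through the closure, so it is enough to treat one morphism out of K^(n)
   and one morphism into it. *)
suff step A B : GTSh_connected A B -> (A = K <-> B = K) by move=> A /step[_]; apply.
elim=> {A B} [A B hAB|A|A B _ [h1 h2]|A B C _ [h1 h2] _ [h3 h4]]; split=> //; auto.
- by move=> EA; move: hAB; rewrite EA => /GTSh_hom_from_Kn.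
- move=> EB; move: hAB; rewrite EB => -[_ [m [f [_ /GT_Kn_ker E kerA]]]].
  by apply: NFI_eq; rewrite -kerA.
Qed.

Lemma dvdz_Nord_Kn (x : int) : (Nord K %| x)%Z -> (n %| x)%Z /\ (2 %| x)%Z.
Proof.
by rewrite Nord_Kn => dx; split; apply: dvdz_trans dx; [exact: dvdn_lcml|exact: dvdn_lcmr].
Qed.

Lemma is_GT_shadow_Kn (m k h : int) (f : F2) :
  coprimez (2 * m + 1)%R (Nord K : int) ->
  (n %| (2 * h - kappa m)%R)%Z ->
  derived_subgroup (quotient (NF2 K)) (\pi_(quotient (NF2 K)) f) ->
  psi (val f) = (dih (2 * k)%R false, dih (- (2 * k))%R false, dih (2 * h)%R false) ->
  is_GT_shadow K m f.
Proof.
move=> cop hh der E; have hex : hexagons K m f.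
  by apply/(hexagons_Kn hn m E); rewrite addrN.
split=> //; apply: (finite_quotient_surj (TmfM hex)).
exact: Tmf_ker_Kn E hex cop.
Qed.

Lemma GT_Kn_sub (q : shadow K) : GT K q -> exists m k : int,
  [/\ X_ n hn m, (4 %| n)%N -> (k = (kappa m %/ 2)%Z %[mod 2])%Z &
      identify n hn q = shadow_triple n m k].
Proof.
move=> [m [f [-> sh]]]; have [hex cop der _] := sh.
have [i [j [k [E ij ik]]]] := derived_even_rotations der.
have [h1 h2] := proj1 (hexagons_Kn hn m E) hex.
rewrite identify_class E; set M := Nord K in cop *; set m' := (m %% M)%Z.
have M0 : (M != 0 :> int)%R by rewrite /M Nord_Kn; have := lcmn_gt0 n 2; lia.
(* Both [n] and 2 divide [Nord K], so reducing [m] keeps its parity and the class of [kappa m]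
   modulo [n]. *)
have [mn m2] : (n %| (m - m')%R)%Z /\ (2 %| (m - m')%R)%Z.
  apply: dvdz_Nord_Kn; rewrite {1}(divz_eq m M) addrK; exact: dvdz_mull.
have h3 : (n %| (2 * k - kappa m')%R)%Z.
  move: h2; rewrite /kappa (_ : (2 %| m')%Z = (2 %| m)%Z); last by lia.
  by case: ifP => _ h2; dvdz_comb_tac h2 mn.
exists m', i; split.
- split; first by rewrite modz_ge0 // ltz_mod.
  rewrite -/M; move: cop; rewrite {1}(divz_eq m M) -/m'.
  have -> : (2 * ((m %/ M)%Z * M + m') + 1 = (2 * (m %/ M)%Z) * M + (2 * m' + 1))%R by ring.
  by rewrite coprimez_sym /coprimez gcdzMDl -/(coprimez _ _) coprimez_sym.
(* When 4 divides [n], the congruence determines [k] modulo 2, and [i] has the same parity as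
   [k]. *)
- move=> n4; have h4 : (4 %| (2 * k - kappa m')%R)%Z by apply: dvdz_trans h3.
  exact: half_kappa ik h4.
- rewrite /shadow_triple -!dih_false; congr (_, (_, _, _)); apply/(dih_eq _ _ _ n1) => //.
  by rewrite opprK addrC.
Qed.

Lemma GT_Kn_sup (m k : int) : X_ n hn m ->
  ((4 %| n)%N -> (k = (kappa m %/ 2)%Z %[mod 2])%Z) ->
  exists2 q, GT K q & identify n hn q = shadow_triple n m k.
Proof.
move=> [mM cop] k4; have kap2 : (2 %| kappa m)%Z by rewrite /kappa; case: ifP; lia.
have [h [kh hk]] : exists h : int, (2 %| (k - h)%R)%Z /\ (n %| (2 * h - kappa m)%R)%Z.
  (* The half of [kappa m] serves as [h] if it has the parity of [k]. *)
  pose h := (kappa m %/ 2)%Z; case: (boolP (2 %| (k - h)%R)%Z) => kh.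
    by exists h; split=> //; rewrite (_ : (_ - _)%R = 0%R) //; rewrite /h; lia.
  have n4 : ~~ (4 %| n)%N by apply/negP => /k4; rewrite -/h; lia.
  (* Otherwise [n] is odd or twice an odd number, and [d] is an odd integer with [2 * d] divisible
     by [n]: adding it changes the parity of [h] but not [2 * h] modulo [n]. *)
  pose d : nat := if odd n then n else n./2.
  exists (h + d)%R; split; first by rewrite /d; case: ifP; lia.
  apply/dvdzP; exists (if odd n then 2%R else 1%R); rewrite /h /d; case: ifP; lia.
have [f [der E]] := even_rotations_derived hn kh.
exists (shadow_class K m f); first by exists m, f; split=> //; exact: is_GT_shadow_Kn hk der E.
rewrite identify_class E /shadow_triple -!dih_false modz_small //.
by congr (_, (_, _, _)); apply/(dih_eq _ _ _ n1).
Qed.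

End GTKn.

Theorem theorem4p3 (n : nat) (hn : (3 <= n)%N) :
  identify n hn @` GT (Kn n hn) =
    (if (4 %| n)%N
     then [set p | exists m k : int,
             [/\ X_ n hn m, (k = (kappa m %/ 2)%Z %[mod 2])%Z & p = shadow_triple n m k]]
     else [set p | exists m k : int, X_ n hn m /\ p = shadow_triple n m k])
  /\ isolated (Kn n hn).
Proof.
split; last exact: isolated_Kn.
case: ifP => n4; apply/seteqP; split=> p.
- by move=> [q /GT_Kn_sub[m [k [Xm /(_ n4) km ->]]] <-]; exists m, k.
- by move=> [m [k [Xm km ->]]]; have [q ? <-] := GT_Kn_sup Xm (fun _ => km); exists q.
- by move=> [q /GT_Kn_sub[m [k [Xm _ ->]]] <-]; exists m, k.
- move=> [m [k [Xm ->]]]; have [|q ? <-] := @GT_Kn_sup _ _ m k Xm; last by exists q.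
  by rewrite n4.
Qed.
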